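(* Let $H$ be a triangular Hopf algebra and $A$ a braided commutative left $H$-module algebra such that $\mathfrak X(A)$ and $\Omega(A)$ are finitely generated and projective as $A$-modules. Let $\nabla:\mathfrak X(A)\to\Omega(A)\otimes_A\mathfrak X(A)$ be a left connection, with torsion $T_\nabla:\mathfrak X(A)\otimes\mathfrak X(A)\to\mathfrak X(A)$, $$T_\nabla(u,v)=\nabla_uv-\nabla_{\bar R^\alpha\triangleright v}(\bar R_\alpha\triangleright u)-[u,v],$$ and let $I=\omega^i\otimes_Ae_i\in\Omega(A)\otimes_A\mathfrak X(A)$ be the canonical element. Then for all $u,v\in\mathfrak X(A)$ $$T_\nabla(u,v)=-\,\mathrm i_u\circ\mathrm i_v\circ\mathrm d_\nabla(I),$$ hence $T_\nabla\in{}_A\mathrm{hom}(\mathfrak X^2(A),\mathfrak X(A))$, i.e. $T_\nabla$ is well defined as a left $A$-linear map $\mathfrak X^2(A)\to\mathfrak X(A)$ (with the identification $T_\nabla(u,v)=\frac12T_\nabla(u\wedge v)$).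
   Context: $\Bbbk$ is a field of characteristic zero, or the ring of formal power series over such a field; $\otimes$ is over $\Bbbk$; algebras are associative and unital; Hopf algebras have invertible antipode $S$; $\Delta(h)=h_{(1)}\otimes h_{(2)}$. $H$ is triangular with universal R-matrix $\mathcal R$ ($\Delta^{cop}(h)=\mathcal R\Delta(h)\mathcal R^{-1}$, $(\Delta\otimes\mathrm{id})\mathcal R=\mathcal R_{13}\mathcal R_{23}$, $(\mathrm{id}\otimes\Delta)\mathcal R=\mathcal R_{13}\mathcal R_{12}$, $\mathcal R_{21}=\mathcal R^{-1}$); write $\mathcal R^{-1}=\bar R^\alpha\otimes\bar R_\alpha$, summation understood. Modules. $A$ is a left $H$-module algebra, braided commutative: $ab=(\bar R^\alpha\triangleright b)(\bar R_\alpha\triangleright a)$. An $H$-equivariant $A$-bimodule is an $A$-bimodule with compatible $H$-action; it is symmetric if $av=(\bar R^\alpha\triangleright v)(\bar R_\alpha\triangleright a)$. Tensor products carry the diagonal $H$-action; the braiding is $\tau(v\otimes_A w)=\bar R^\alpha\triangleright w\otimes_A\bar R_\alpha\triangleright v$. ${}_A\mathrm{hom}(V,W)$ denotes the left $A$-linear maps $V\to W$, with $H$-action $h\triangleright^{cop}L=h_{(2)}\triangleright\circ L\circ S^{-1}(h_{(1)})\triangleright$. Vector fields. $\mathfrak X(A)$ is the set of braided derivations: $\Bbbk$-linear $u:A\to A$ with $u(ab)=u(a)b+(\bar R^\alpha\triangleright a)(\bar R_\alpha\triangleright u)(b)$, where $(h\triangleright u)(a)=h_{(1)}\triangleright(u(S(h_{(2)})\triangleright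 a))$. It is a symmetric $H$-equivariant $A$-bimodule with $(au)(b)=a\,u(b)$, $ua=(\bar R^\alpha\triangleright a)(\bar R_\alpha\triangleright u)$, and bracket $[u,v]=u\circ v-(\bar R^\alpha\triangleright v)\circ(\bar R_\alpha\triangleright u)$. $\mathfrak X^2(A)\subset\mathfrak X(A)\otimes_A\mathfrak X(A)$ is the image of $\frac12(\mathrm{id}-\tau)$, and $u\wedge v=u\otimes_Av-\bar R^\alpha\triangleright v\otimes_A\bar R_\alpha\triangleright u$. Forms. ${}^*\mathfrak X(A)={}_A\mathrm{hom}(\mathfrak X(A),A)$, $\langle u,\omega\rangle:=\omega(u)$, with $(\omega a)(u)=\omega(u)a$, $(a\omega)(u)=\omega(ua)$ and $H$-action $\triangleright^{cop}$. $\mathrm d:A\to{}^*\mathfrak X(A)$ is $\langle u,\mathrm da\rangle=u(a)$; $\Omega(A):=A\,\mathrm dA$ (under the projectivity assumption $\Omega(A)={}^*\mathfrak X(A)$). $\{e_i\in\mathfrak X(A),\omega^i\in\Omega(A)\}$ is a (finite) pair of dual bases: $u=\langle u,\omega^i\rangle e_i$ for all $u$; $I=\omega^i\otimes_Ae_i$ does not depend on the choice. $\Omega^r(A)\subset\Omega(A)^{\otimes_Ar}$ is the image of $A_r=\frac1{r!}\sum_\wp\mathrm{sign}(\wp)\Pi_\wp$, with $\Pi$ the representation of the permutation group generated by $\tau$ on adjacent factors; $\theta\wedge\theta'=\frac{(r+r')!}{r!r'!}A_{r+r'}(\theta\otimes_A\theta')$ for $\theta\in\Omega^r(A),\theta'\in\Omega^{r'}(A)$.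 $\mathrm d$ extends uniquely to an $H$-equivariant degree-one map on $\Omega^\bullet(A)$ with $\mathrm d^2=0$ and the graded Leibniz rule. $\mathrm i_u:\Omega^\bullet(A)\to\Omega^{\bullet-1}(A)$ is the restriction of $\omega\otimes_A\eta\mapsto\langle u,\omega\rangle\eta$ (zero on $A$). Connections. A left connection on a symmetric $H$-equivariant $A$-bimodule $\Gamma$ is a $\Bbbk$-linear map $\nabla:\Gamma\to\Omega(A)\otimes_A\Gamma$ with $\nabla(as)=\mathrm da\otimes_As+a\nabla(s)$. It extends by $\mathrm d_\nabla(\theta\otimes_As)=\mathrm d\theta\otimes_As+(-1)^k\theta\wedge\nabla(s)$ for $\theta\in\Omega^k(A)$. One sets $\mathrm i_u(\theta\otimes_As)=\mathrm i_u(\theta)\otimes_As$ and $\nabla_u:=\mathrm i_u\circ\nabla$. *)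

(* Defs.v *)
From HB Require Import structures.
From mathcomp Require Import all_boot fingroup perm ssralg.
From mathcomp Require Import generic_quotient boolp classical_sets functions.

Set Implicit Arguments.
Unset Strict Implicit.
Unset Printing Implicit Defensive.

Import GRing.Theory.
Local Open Scope ring_scope.
Local Open Scope quotient_scope.

Section LinearProp.
Variables (k : comUnitRingType) (U V : lmodType k) (f : U -> V).
Hypothesis lf : linear f.

Definition bundle_linear : {linear U -> V} :=
  HB.pack f (GRing.isLinear.Build k U V _ f lf).
Lemma linD u v : f (u + v) = f u + f v. Proof. exact: (raddfD bundle_linear). Qed.
Lemma linN u : f (- u) = - f u. Proof. exact: (raddfN bundle_linear). Qed.
Lemma lin0 : f 0 = 0. Proof. exact: (raddf0 bundle_linear). Qed.
Lemma linZ c u : f (c *: u) = c *: f u. Proof. exact: (linearZ_LR bundle_linear). Qed.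
Lemma lin_sum (I : Type) (s : seq I) (P : pred I) (F : I -> U) :
  f (\sum_(i <- s | P i) F i) = \sum_(i <- s | P i) f (F i).
Proof. exact: (raddf_sum bundle_linear). Qed.

End LinearProp.

Section Tensor.
Variables (k : comUnitRingType) (B : Type) (V W : lmodType k).
Variables (r : V -> B -> V) (l : B -> W -> W).

Definition balanced (M : lmodType k) (f : V -> W -> M) : Prop :=
  [/\ forall w, linear (f^~ w), forall v, linear (f v)
    & forall v b w, f (r v b) w = f v (l b w)].

(* Finite lists of pairs stand for formal sums of pure tensors; two of them are
   equal in the tensor product over B when no balanced map separates them. *)
Definition tens_equiv (s t : seq (V * W)) : bool :=
  `[< forall (M : lmodType k) (f : V -> W -> M), balanced f ->
        \sum_(p <- s) f p.1 p.2 = \sum_(p <- t) f p.1 p.2 >].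

Lemma tens_equiv_refl : reflexive tens_equiv.
Proof. by move=> s; apply/asboolP. Qed.
Lemma tens_equiv_sym : symmetric tens_equiv.
Proof. by move=> s t; apply/asboolP/asboolP => E M f bf; rewrite E. Qed.
Lemma tens_equiv_trans : transitive tens_equiv.
Proof.
by move=> s t u /asboolP E /asboolP E'; apply/asboolP => M f bf; rewrite E // E'.
Qed.

Canonical tens_equivR :=
  EquivRel tens_equiv tens_equiv_refl tens_equiv_sym tens_equiv_trans.

Definition tens : Type := {eq_quot tens_equivR}.
HB.instance Definition _ := Choice.on tens.
HB.instance Definition _ := EqQuotient.on tens.

(* The sum of the f v w over a representative of t. It does not depend on the
   representative when f is balanced (tlift_tpair, tlift_linear), and all uses
   in definitions below are of that kind. *)
Definition tlift (M : lmodType k) (f : V -> W -> M) (t : tens) : M :=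
  \sum_(p <- repr t) f p.1 p.2.

Let piS (s : seq (V * W)) : tens := \pi_tens s.

Lemma tlift_pi (M : lmodType k) (f : V -> W -> M) s : balanced f ->
  tlift f (piS s) = \sum_(p <- s) f p.1 p.2.
Proof.
move=> bf; rewrite /tlift; case: piP => t /eqmodP /asboolP E.
by rewrite -E.
Qed.

Lemma tens_ext (s t : tens) :
  (forall (M : lmodType k) (f : V -> W -> M), balanced f -> tlift f s = tlift f t)
   <-> s = t.
Proof.
split=> [E|-> //]; rewrite -[s]reprK -[t]reprK; apply/eqmodP/asboolP => M f bf.
exact: E.
Qed.

Definition tens_zero : tens := piS [::].
Definition tens_add (s t : tens) : tens := piS (repr s ++ repr t).
Definition tens_scale (c : k) (s : tens) : tens :=
  piS [seq (c *: p.1, p.2) | p <- repr s].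
Definition tens_opp := tens_scale (-1).

Lemma tlift_zero (M : lmodType k) (f : V -> W -> M) : balanced f ->
  tlift f tens_zero = 0.
Proof. by move=> bf; rewrite tlift_pi // big_nil. Qed.
Lemma tlift_add (M : lmodType k) (f : V -> W -> M) s t : balanced f ->
  tlift f (tens_add s t) = tlift f s + tlift f t.
Proof. by move=> bf; rewrite tlift_pi // big_cat. Qed.
Lemma tlift_scale (M : lmodType k) (f : V -> W -> M) c s : balanced f ->
  tlift f (tens_scale c s) = c *: tlift f s.
Proof.
move=> bf; rewrite tlift_pi // big_map scaler_sumr; apply: eq_bigr => p _ /=.
by case: bf => /(_ p.2) lf _ _; rewrite (linZ lf).
Qed.

Fact tens_addA : associative tens_add.
Proof. by move=> s t u; apply/tens_ext => M f bf; rewrite !tlift_add // addrA. Qed.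
Fact tens_addC : commutative tens_add.
Proof. by move=> s t; apply/tens_ext => M f bf; rewrite !tlift_add // addrC. Qed.
Fact tens_add0 : left_id tens_zero tens_add.
Proof.
by move=> s; apply/tens_ext => M f bf; rewrite !tlift_add // tlift_zero // add0r.
Qed.
Fact tens_addN : left_inverse tens_zero tens_opp tens_add.
Proof.
move=> s; apply/tens_ext => M f bf.
by rewrite !tlift_add // tlift_zero // tlift_scale // scaleN1r addNr.
Qed.
HB.instance Definition _ := GRing.isZmodule.Build tens
  tens_addA tens_addC tens_add0 tens_addN.

Fact tens_scaleA a b v : tens_scale a (tens_scale b v) = tens_scale (a * b) v.
Proof. by apply/tens_ext => M f bf; rewrite !tlift_scale // scalerA. Qed.
Fact tens_scale1 : left_id 1 tens_scale.
Proof. by move=> s; apply/tens_ext => M f bf; rewrite !tlift_scale // scale1r. Qed.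
Fact tens_scaleDr : right_distributive tens_scale +%R.
Proof.
move=> a s t; apply/tens_ext => M f bf.
by rewrite !(tlift_add, tlift_scale) // scalerDr.
Qed.
Fact tens_scaleDl v : {morph tens_scale^~ v : a b / a + b}.
Proof.
move=> a b; apply/tens_ext => M f bf.
by rewrite !(tlift_add, tlift_scale) // scalerDl.
Qed.
HB.instance Definition _ := GRing.Zmodule_isLmodule.Build k tens
  tens_scaleA tens_scale1 tens_scaleDr tens_scaleDl.

Definition tpair (v : V) (w : W) : tens := piS [:: (v, w)].

Lemma tlift_tpair (M : lmodType k) (f : V -> W -> M) v w : balanced f ->
  tlift f (tpair v w) = f v w.
Proof. by move=> bf; rewrite tlift_pi // big_seq1. Qed.

Lemma tlift_linear (M : lmodType k) (f : V -> W -> M) : balanced f ->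
  linear (tlift f).
Proof. by move=> bf c s t; rewrite tlift_add // tlift_scale. Qed.

Lemma tpair_balanced : balanced tpair.
Proof.
split=> [w c v v'|v c w w'|v b w]; apply/tens_ext => M f bf;
  rewrite ?tlift_linear // !tlift_tpair //; case: bf => bl br bb.
- exact: bl.
- exact: br.
- exact: bb.
Qed.

Lemma repr_tpair (t : tens) : t = \sum_(p <- repr t) tpair p.1 p.2.
Proof.
apply/tens_ext => M f bf; rewrite [LHS]/tlift.
rewrite (lin_sum (tlift_linear bf)); apply: eq_bigr => p _.
by rewrite tlift_tpair.
Qed.

Lemma tens_lin_ext (M : lmodType k) (f g : tens -> M) :
  linear f -> linear g -> (forall v w, f (tpair v w) = g (tpair v w)) -> f =1 g.
Proof.
move=> lf lg E t.
rewrite (repr_tpair t) (lin_sum lf) (lin_sum lg).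
by apply: eq_bigr => p _; apply: E.
Qed.

End Tensor.

(* Sweedler notation: the sum of E over t = x (x) y, summation understood. *)
Notation "\sw_ ( x , y <- t ) E" := (tlift (fun x y => E) t)
  (at level 41, E at level 41, x name, y name, t at level 40,
   format "'[' \sw_ ( x ,  y  <-  t ) '/  '  E ']'") : ring_scope.

Notation tensk V W := (tens (V := V) (W := W) (fun v c => c *: v) (fun c w => c *: w)).
Notation "x ⊗ y" := (tpair (fun v c => c *: v) (fun c w => c *: w) x y)
  (at level 40, left associativity) : ring_scope.

Definition bilin (k : comUnitRingType) (U V W : lmodType k) (f : U -> V -> W) :=
  (forall v, linear (f^~ v)) /\ (forall u, linear (f u)).

Section LinLemmas.
Variable k : comUnitRingType.
Implicit Types U V W M : lmodType k.

Lemma lin_id U : linear (fun x : U => x). Proof. by []. Qed.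
Lemma lin_app U V W (f : V -> W) (g : U -> V) : linear f -> linear g ->
  linear (fun x => f (g x)).
Proof. by move=> lf lg c x y; rewrite lg lf. Qed.
Lemma lin_scale U V (c : k) (g : U -> V) : linear g -> linear (fun x => c *: g x).
Proof. by move=> lg d x y; rewrite lg scalerDr !scalerA mulrC. Qed.
Lemma lin_scalel U V (v : V) (g : U -> k^o) : linear g ->
  linear (fun x => (g x : k) *: v).
Proof. by move=> lg d x y; rewrite lg scalerDl !scalerA. Qed.
Lemma lin_add U V (f g : U -> V) : linear f -> linear g -> linear (fun x => f x + g x).
Proof. by move=> lf lg c x y; rewrite lf lg scalerDr addrACA. Qed.
Lemma lin_opp U V (f : U -> V) : linear f -> linear (fun x => - f x).
Proof. by move=> lf c x y; rewrite lf opprD scalerN. Qed.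
Lemma lin_bigsum U V (I : Type) (s : seq I) (P : pred I) (F : U -> I -> V) :
  (forall i, linear (F^~ i)) -> linear (fun x => \sum_(i <- s | P i) F x i).
Proof.
move=> lF c x y; rewrite scaler_sumr -big_split; apply: eq_bigr => i _ /=.
exact: lF.
Qed.
Lemma lin_mull U (B : algType k) (g : U -> B) (b : B) : linear g ->
  linear (fun x => g x * b).
Proof. by move=> lg c x y; rewrite lg mulrDl scalerAl. Qed.
Lemma lin_mulr U (B : algType k) (g : U -> B) (b : B) : linear g ->
  linear (fun x => b * g x).
Proof. by move=> lg c x y; rewrite lg mulrDr scalerAr. Qed.

Lemma balk V W M (f : V -> W -> M) : bilin f ->
  balanced (fun (v : V) (c : k) => c *: v) (fun c w => c *: w) f.
Proof. by case=> l r; split=> // v b w; rewrite (linZ (l w)) (linZ (r v)). Qed.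

Section Gen.
Variables (B : Type) (V W M : lmodType k) (r : V -> B -> V) (l : B -> W -> W).
Notation T := (tens r l).

Lemma lin_tlift U (f : V -> W -> M) (g : U -> T) : balanced r l f -> linear g ->
  linear (fun x => tlift f (g x)).
Proof. by move=> bf; apply: lin_app; apply: tlift_linear. Qed.
Lemma lin_tliftc U (f : U -> V -> W -> M) (t : T) :
  (forall v w, linear (fun x => f x v w)) -> linear (fun x => tlift (f x) t).
Proof. by move=> lf; apply: lin_bigsum => p; apply: lf. Qed.
Lemma lin_tpairl U (g : U -> V) w : linear g ->
  linear (fun x => tpair r l (g x) w).
Proof. by move=> lg c x y; rewrite lg; case: (tpair_balanced r l) => + _ _; exact. Qed.
Lemma lin_tpairr U (g : U -> W) v : linear g ->
  linear (fun x => tpair r l v (g x)).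
Proof. by move=> lg c x y; rewrite lg; case: (tpair_balanced r l) => _ + _; exact. Qed.

Lemma tlift_app (M' : lmodType k) (f : M -> M') (g : V -> W -> M) (t : T) :
  linear f -> f (tlift g t) = tlift (fun v w => f (g v w)) t.
Proof. by move=> lf; rewrite /tlift (lin_sum lf). Qed.
Lemma tlift_eq (f g : V -> W -> M) (t : T) :
  (forall v w, f v w = g v w) -> tlift f t = tlift g t.
Proof. by move=> E; apply: eq_bigr => p _; apply: E. Qed.
Lemma tlift_add2 (f g : V -> W -> M) (t : T) :
  tlift (fun v w => f v w + g v w) t = tlift f t + tlift g t.
Proof. by rewrite /tlift big_split. Qed.
Lemma tpairDl v v' w : tpair r l (v + v') w = tpair r l v w + tpair r l v' w.
Proof. by rewrite (linD (lin_tpairl w (@lin_id V))). Qed.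
Lemma tpairDr v w w' : tpair r l v (w + w') = tpair r l v w + tpair r l v w'.
Proof. by rewrite (linD (lin_tpairr v (@lin_id W))). Qed.
Lemma tpairZl c v w : tpair r l (c *: v) w = c *: tpair r l v w.
Proof. by rewrite (linZ (lin_tpairl w (@lin_id V))). Qed.
Lemma tpairZr c v w : tpair r l v (c *: w) = c *: tpair r l v w.
Proof. by rewrite (linZ (lin_tpairr v (@lin_id W))). Qed.
Lemma tpair_bal v b w : tpair r l (r v b) w = tpair r l v (l b w).
Proof. by case: (tpair_balanced r l). Qed.
End Gen.

Lemma exch_tlift B V W (r : V -> B -> V) (l : B -> W -> W) B' V' W'
  (r' : V' -> B' -> V') (l' : B' -> W' -> W') M (f : V -> W -> V' -> W' -> M)
  (s : tens r l) (t : tens r' l') :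
  \sw_(a, b <- s) \sw_(c, d <- t) f a b c d =
  \sw_(c, d <- t) \sw_(a, b <- s) f a b c d.
Proof. by rewrite /tlift exchange_big. Qed.
End LinLemmas.

Arguments lin_id {k U}.

Ltac lin_more := fail.
Ltac lin_step :=
  match goal with
  | |- balanced _ _ _ => apply: balk
  | |- bilin _ => split=> ? /=
  | |- _ => first
    [ exact: lin_id | assumption
    | lin_more
    | apply: lin_mull | apply: lin_mulr
    | apply: lin_tpairl | apply: lin_tpairr
    | apply: lin_tliftc => ? ? /= | apply: lin_tlift
    | apply: lin_scale | apply: lin_scalel | apply: lin_add | apply: lin_opp ]
  end.
Ltac lin := repeat lin_step.

(* antiV is the inverse of the antipode anti. *)
Record hopfAlg (k : comUnitRingType) := HopfAlg {
  hopf_alg :> algType k;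
  cop : hopf_alg -> tensk hopf_alg hopf_alg;
  cou : hopf_alg -> k^o;
  anti : hopf_alg -> hopf_alg;
  antiV : hopf_alg -> hopf_alg;
  cop_lin : linear cop;
  cou_lin : linear cou;
  anti_lin : linear anti;
  cop_coassoc : forall h,
    \sw_(x, y <- cop h) \sw_(a, b <- cop x) (a ⊗ (b ⊗ y))
    = \sw_(x, y <- cop h) \sw_(a, b <- cop y)
        (x ⊗ (a ⊗ b));
  cop_coul : forall h, \sw_(x, y <- cop h) ((cou x : k) *: y) = h;
  cop_cour : forall h, \sw_(x, y <- cop h) ((cou y : k) *: x) = h;
  cop1 : cop 1 = 1 ⊗ 1;
  copM : forall g h, cop (g * h) =
    \sw_(a, b <- cop g) \sw_(c, d <- cop h) ((a * c) ⊗ (b * d));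
  cou1 : cou 1 = 1;
  couM : forall g h, cou (g * h) = (cou g : k) * cou h;
  antil : forall h, \sw_(x, y <- cop h) (anti x * y) = (cou h : k) *: 1;
  antir : forall h, \sw_(x, y <- cop h) (x * anti y) = (cou h : k) *: 1;
  antiK : cancel anti antiV;
  antiVK : cancel antiV anti
}.

Section TensorSquare.
Variables (k : comUnitRingType) (H : algType k).
Notation HH := (tensk H H).

Definition HHmul (s t : HH) : HH :=
  \sw_(a, b <- s) \sw_(c, d <- t) ((a * c) ⊗ (b * d)).
Definition HHone : HH := 1 ⊗ 1.
Definition HHflip (s : HH) : HH := \sw_(a, b <- s) (b ⊗ a).
End TensorSquare.

Record triHopf (k : comUnitRingType) := TriHopf {
  tri_hopf :> hopfAlg k;
  Rmat : tensk tri_hopf tri_hopf;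
  Rinv : tensk tri_hopf tri_hopf;
  RmatK : HHmul Rmat Rinv = HHone tri_hopf;
  RinvK : HHmul Rinv Rmat = HHone tri_hopf;
  Rmat_cop : forall h, HHflip (cop h) = HHmul (HHmul Rmat (cop h)) Rinv;
  Rmat_copl : \sw_(x, y <- Rmat) \sw_(a, b <- cop x) (a ⊗ (b ⊗ y))
    = \sw_(a, b <- Rmat) \sw_(c, d <- Rmat)
        (a ⊗ (c ⊗ (b * d)));
  Rmat_copr : \sw_(x, y <- Rmat) \sw_(a, b <- cop y) (x ⊗ (a ⊗ b))
    = \sw_(a, b <- Rmat) \sw_(c, d <- Rmat)
        ((a * c) ⊗ (d ⊗ b));
  Rmat_tri : HHflip Rmat = Rinv
}.

Section HopfTheory.
Variables (k : comUnitRingType) (H : hopfAlg k).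
Notation S := (@anti k H).
Notation T := (@antiV k H).
Notation eps h := (@cou k H h : k).

Lemma antiV_lin : linear T.
Proof.
by move=> c x y; apply: (can_inj (@antiK k H)); rewrite antiVK anti_lin !antiVK.
Qed.

Lemma lin_cop (U : lmodType k) (g : U -> H) : linear g -> linear (fun x => cop (g x)).
Proof. by apply: lin_app; apply: cop_lin. Qed.
Lemma lin_cou (U : lmodType k) (g : U -> H) : linear g -> linear (fun x => cou (g x)).
Proof. by apply: lin_app; apply: cou_lin. Qed.
Lemma lin_anti (U : lmodType k) (g : U -> H) : linear g -> linear (fun x => S (g x)).
Proof. by apply: lin_app; apply: anti_lin. Qed.
Lemma lin_antiV (U : lmodType k) (g : U -> H) : linear g -> linear (fun x => T (g x)).
Proof. by apply: lin_app; apply: antiV_lin. Qed.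
Ltac lin_more ::= first
  [apply: lin_cop | apply: lin_cou | apply: lin_anti | apply: lin_antiV].

Section Tri.
Variables (M : lmodType k) (F : H -> H -> H -> M).
Hypothesis F1 : forall y z, linear (fun x => F x y z).
Hypothesis F2 : forall x z, linear (fun y => F x y z).
Hypothesis F3 : forall x y, linear (fun z => F x y z).

Definition tlift3 (t : tensk H (tensk H H)) : M :=
  \sw_(x, s <- t) \sw_(y, z <- s) F x y z.
Lemma tlift3_lin : linear tlift3.
Proof. rewrite /tlift3; lin; exact: F1 || exact: F2 || exact: F3. Qed.
Lemma tlift3_tpair x y z : tlift3 (tpair _ _ x (tpair _ _ y z)) = F x y z.
Proof. by rewrite /tlift3 !tlift_tpair //; lin. Qed.

Lemma coassocE h :
  \sw_(x, y <- cop h) \sw_(a, b <- cop x) F a b y =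
  \sw_(x, y <- cop h) \sw_(a, b <- cop y) F x a b.
Proof.
move: (congr1 tlift3 (cop_coassoc h)); rewrite !(tlift_app _ _ tlift3_lin).
under tlift_eq => x y do rewrite (tlift_app _ _ tlift3_lin).
under [in X in _ = X -> _]tlift_eq => x y do rewrite (tlift_app _ _ tlift3_lin).
under tlift_eq => x y do under tlift_eq => a b do rewrite tlift3_tpair.
under [in X in _ = X -> _]tlift_eq => x y do
  under tlift_eq => a b do rewrite tlift3_tpair.
by [].
Qed.
End Tri.
End HopfTheory.

Ltac lin_more ::= first
  [apply: lin_cop | apply: lin_cou | apply: lin_anti | apply: lin_antiV].

Section HopfTheory2.
Variables (k : comUnitRingType) (H : hopfAlg k).
Notation S := (@anti k H).
Notation T := (@antiV k H).
Notation eps h := (@cou k H h : k).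
Implicit Types (M : lmodType k) (g h : H).

Lemma counitlE M (F : H -> M) (G : H -> H -> M) h : linear F ->
  (forall x y, G x y = eps x *: F y) -> tlift G (cop h) = F h.
Proof.
move=> lF E; rewrite -[in RHS](cop_coul h) (tlift_app _ _ lF).
by apply: tlift_eq => x y; rewrite E (linZ lF).
Qed.
Lemma counitrE M (F : H -> M) (G : H -> H -> M) h : linear F ->
  (forall x y, G x y = eps y *: F x) -> tlift G (cop h) = F h.
Proof.
move=> lF E; rewrite -[in RHS](cop_cour h) (tlift_app _ _ lF).
by apply: tlift_eq => x y; rewrite E (linZ lF).
Qed.
Lemma antilE M (F : H -> M) (G : H -> H -> M) R h : linear F ->
  (forall x y, G x y = F (S x * y)) -> F 1 = R -> tlift G (cop h) = eps h *: R.
Proof.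
move=> lF E <-; rewrite -(linZ lF) -antil (tlift_app _ _ lF).
by apply: tlift_eq => x y; rewrite E.
Qed.
Lemma antirE M (F : H -> M) (G : H -> H -> M) R h : linear F ->
  (forall x y, G x y = F (x * S y)) -> F 1 = R -> tlift G (cop h) = eps h *: R.
Proof.
move=> lF E <-; rewrite -(linZ lF) -antir (tlift_app _ _ lF).
by apply: tlift_eq => x y; rewrite E.
Qed.
Lemma copME M (F : H -> H -> M) g h : bilin F ->
  \sw_(x, y <- cop (g * h)) F x y =
  \sw_(a, b <- cop g) \sw_(c, d <- cop h) F (a * c) (b * d).
Proof.
move=> bF; have lF := tlift_linear (balk bF).
rewrite copM (tlift_app _ _ lF); apply: tlift_eq => a b.
rewrite (tlift_app _ _ lF); apply: tlift_eq => c d.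
by rewrite tlift_tpair //; apply: balk.
Qed.
Lemma cop1E M (F : H -> H -> M) : bilin F -> \sw_(x, y <- cop (1 : H)) F x y = F 1 1.
Proof. by move=> bF; rewrite cop1 tlift_tpair //; apply: balk. Qed.

Lemma anti1 : S 1 = 1.
Proof.
by have := antir (1 : H); rewrite cop1E ?mul1r ?cou1 ?scale1r //; lin.
Qed.

Lemma antiM_aux g h : \sw_(c, d <- cop h) (c * S (g * d)) = eps h *: S g.
Proof.
pose F a b e := \sw_(c, d <- cop h) (S a * (b * c * S (e * d))).
have F1 b e : linear (fun a => F a b e) by rewrite /F; lin.
have F2 a e : linear (fun b => F a b e) by rewrite /F; lin.
have F3 a b : linear (fun e => F a b e) by rewrite /F; lin.
transitivity (\sw_(x, e <- cop g) \sw_(a, b <- cop x) F a b e).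
  symmetry; apply: (counitlE (F := fun e => \sw_(c, d <- cop h) (c * S (e * d)))).
    by lin.
  move=> x e.
  apply: (antilE (F := fun u => \sw_(c, d <- cop h) (u * (c * S (e * d))))).
  - by lin.
  - by move=> a b; apply: tlift_eq => c d; rewrite !mulrA.
  - by apply: tlift_eq => c d; rewrite mul1r.
rewrite coassocE //; apply: (counitrE (F := fun a => eps h *: S a)); first by lin.
move=> a y; transitivity (S a * \sw_(x, z <- cop (y * h)) (x * S z)).
  rewrite copME; last by lin.
  rewrite (tlift_app _ _ (lin_mulr _ lin_id)); apply: tlift_eq => b e.
  by rewrite (tlift_app _ _ (lin_mulr _ lin_id)).
by rewrite antir couM -scalerAr mulr1 scalerA.
Qed.

Lemma antiM g h : S (g * h) = S h * S g.
Proof.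
pose F a b d := S a * b * S (g * d).
have F1 b e : linear (fun a => F a b e) by rewrite /F; lin.
have F2 a e : linear (fun b => F a b e) by rewrite /F; lin.
have F3 a b : linear (fun e => F a b e) by rewrite /F; lin.
transitivity (\sw_(x, d <- cop h) \sw_(a, b <- cop x) F a b d).
  symmetry; apply: (counitlE (F := fun d => S (g * d))); first by lin.
  move=> x d; apply: (antilE (F := fun u => u * S (g * d))) => //.
  - by lin.
  - by rewrite mul1r.
rewrite coassocE //; apply: (counitrE (F := fun a => S a * S g)); first by lin.
move=> a y; transitivity (S a * (\sw_(b, d <- cop y) (b * S (g * d)))).
  rewrite (tlift_app _ _ (lin_mulr _ lin_id)); apply: tlift_eq => b d.
  by rewrite mulrA.
by rewrite antiM_aux scalerAr.
Qed.

Section AntiCop.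
Variables (M : lmodType k) (F : H -> H -> M).
Hypothesis bF : bilin F.
Let Fl (U : lmodType k) (g : U -> H) w : linear g -> linear (fun x => F (g x) w).
Proof. by apply: (lin_app (f := F^~ w)); case: bF. Qed.
Let Fr (U : lmodType k) (g : U -> H) w : linear g -> linear (fun x => F w (g x)).
Proof. by apply: (lin_app (f := F w)); case: bF. Qed.
Ltac lin' := repeat first [lin_step | apply: Fl | apply: Fr].

Lemma anti_cop1 h :
  \sw_(b, y <- cop h) \sw_(p, q <- cop (S y)) F p (b * q) = F (S h) 1.
Proof.
have step0 a0 z : \sw_(x, y <- cop z) \sw_(a, b <- cop x) \sw_(p, q <- cop (S y))
     F (S a0 * (a * p)) (b * q) = eps z *: F (S a0) 1.
  apply: (antirE (F := fun u => \sw_(c, d <- cop u) F (S a0 * c) d)).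
  - by lin'.
  - by move=> x y; rewrite copME //; lin'.
  - by rewrite cop1E ?mulr1 //; lin'.
pose K a0 a w :=
  \sw_(b, y <- cop w) \sw_(p, q <- cop (S y)) F (S a0 * (a * p)) (b * q).
have K1 a w : linear (fun a0 => K a0 a w) by rewrite /K; lin'.
have K2 a w : linear (fun a0 => K a a0 w) by rewrite /K; lin'.
have K3 a w : linear (fun a0 => K a w a0) by rewrite /K; lin'.
transitivity (\sw_(x, w <- cop h) \sw_(a0, a <- cop x) K a0 a w).
  symmetry.
  apply: (counitlE (F := fun w => \sw_(b, y <- cop w) \sw_(p, q <- cop (S y)) F p (b * q))).
    by lin'.
  move=> x w; apply: (antilE (F := fun u =>
    \sw_(b, y <- cop w) \sw_(p, q <- cop (S y)) F (u * p) (b * q))).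
  - by lin'.
  - by move=> a0 a; do 2!apply: tlift_eq => ? ?; rewrite mulrA.
  - by do 2!apply: tlift_eq => ? ?; rewrite mul1r.
rewrite coassocE //; apply: (counitrE (F := fun a => F (S a) 1)); first by lin'.
move=> a0 z; rewrite -step0; symmetry.
apply: (coassocE (F := fun a b y =>
  \sw_(p, q <- cop (S y)) F (S a0 * (a * p)) (b * q))); move=> *; lin'.
Qed.
End AntiCop.

Lemma anti_cop M (F : H -> H -> M) h : bilin F ->
  \sw_(p, q <- cop (S h)) F p q = \sw_(a, b <- cop h) F (S b) (S a).
Proof.
case=> lF rF.
have Fl (U : lmodType k) (g : U -> H) w : linear g -> linear (fun x => F (g x) w).
  by apply: (lin_app (f := F^~ w)).
have Fr (U : lmodType k) (g : U -> H) w : linear g -> linear (fun x => F w (g x)).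
  by apply: (lin_app (f := F w)).
pose K a b y := \sw_(p, q <- cop (S y)) F p (S a * (b * q)).
have K1 a w : linear (fun a0 => K a0 a w).
  by rewrite /K; repeat first [lin_step | apply: Fl | apply: Fr].
have K2 a w : linear (fun a0 => K a a0 w).
  by rewrite /K; repeat first [lin_step | apply: Fl | apply: Fr].
have K3 a w : linear (fun a0 => K a w a0).
  by rewrite /K; repeat first [lin_step | apply: Fl | apply: Fr].
transitivity (\sw_(x, y <- cop h) \sw_(a, b <- cop x) K a b y).
  symmetry; apply: (counitlE (F := fun w => \sw_(p, q <- cop (S w)) F p q)).
    by repeat first [lin_step | apply: Fl | apply: Fr].
  move=> x y; apply: (antilE (F := fun u => \sw_(p, q <- cop (S y)) F p (u * q))).
  - by repeat first [lin_step | apply: Fl | apply: Fr].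
  - by move=> a b; apply: tlift_eq => p q; rewrite mulrA.
  - by apply: tlift_eq => p q; rewrite mul1r.
rewrite coassocE //; apply: tlift_eq => a y.
have bK : bilin (fun p q => F p (S a * q)).
  by split=> w /=; [apply: Fl | apply: Fr]; lin.
by rewrite (anti_cop1 bK) mulr1.
Qed.

Lemma antiV1 : T 1 = 1. Proof. by rewrite -[in LHS]anti1 antiK. Qed.
Lemma antiVM g h : T (g * h) = T h * T g.
Proof. by apply: (can_inj (@antiK k H)); rewrite antiM !antiVK. Qed.
Lemma antiV_cop M (F : H -> H -> M) h : bilin F ->
  \sw_(p, q <- cop (T h)) F p q = \sw_(a, b <- cop h) F (T b) (T a).
Proof.
case=> lF rF.
rewrite -[in RHS](antiVK h) anti_cop.
  by apply: tlift_eq => a b; rewrite !antiK.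
split=> ? /=; [apply: (lin_app (f := F _))|apply: (lin_app (f := F^~ _))] => //;
  exact: antiV_lin.
Qed.
Lemma antiVl h : \sw_(x, y <- cop h) (T y * x) = eps h *: 1.
Proof.
rewrite -antiV1 -(linZ (@antiV_lin k H)) -antil (tlift_app _ _ (@antiV_lin k H)).
by apply: tlift_eq => x y; rewrite antiVM antiK.
Qed.
Lemma antiVr h : \sw_(x, y <- cop h) (y * T x) = eps h *: 1.
Proof.
rewrite -antiV1 -(linZ (@antiV_lin k H)) -antir (tlift_app _ _ (@antiV_lin k H)).
by apply: tlift_eq => x y; rewrite antiVM antiK.
Qed.
Lemma antiVlE M (F : H -> M) (G : H -> H -> M) R h : linear F ->
  (forall x y, G x y = F (T y * x)) -> F 1 = R -> tlift G (cop h) = eps h *: R.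
Proof.
move=> lF E <-; rewrite -(linZ lF) -antiVl (tlift_app _ _ lF).
by apply: tlift_eq => x y; rewrite E.
Qed.
Lemma antiVrE M (F : H -> M) (G : H -> H -> M) R h : linear F ->
  (forall x y, G x y = F (y * T x)) -> F 1 = R -> tlift G (cop h) = eps h *: R.
Proof.
move=> lF E <-; rewrite -(linZ lF) -antiVr (tlift_app _ _ lF).
by apply: tlift_eq => x y; rewrite E.
Qed.
End HopfTheory2.

Lemma lin_binl (k : comUnitRingType) (X U V W : lmodType k) (f : U -> V -> W)
  (g : X -> U) v : bilin f -> linear g -> linear (fun x => f (g x) v).
Proof. by case=> l _; apply: (lin_app (f := f^~ v)). Qed.
Lemma lin_binr (k : comUnitRingType) (X U V W : lmodType k) (f : U -> V -> W)
  (g : X -> V) u : bilin f -> linear g -> linear (fun x => f u (g x)).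
Proof. by case=> _ r; apply: (lin_app (f := f u)). Qed.
Ltac blin := repeat first
  [ lin_step
  | match goal with B : bilin ?f |- _ =>
      first [apply: (lin_binl (f := f) _ B) | apply: (lin_binr (f := f) _ B)]
    end ].

Section RmatTheory.
Variables (k : comUnitRingType) (H : triHopf k).
Notation S := (@anti k H).
Notation T := (@antiV k H).
Notation eps h := (@cou k H h : k).
Notation HH := (tensk H H).
Notation Rb := (Rinv H).
Implicit Types (M : lmodType k).

Lemma tensk_ext (s t : HH) :
  (forall (M : lmodType k) (f : H -> H -> M), bilin f -> tlift f s = tlift f t) ->
  s = t.
Proof. by move=> E; apply/tens_ext => M f [l r _]; apply: E. Qed.

Lemma HHmulE M (F : H -> H -> M) (s t : HH) : bilin F ->
  tlift F (HHmul s t) = \sw_(a, b <- s) \sw_(c, d <- t) F (a * c) (b * d).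
Proof.
move=> bF; rewrite /HHmul; have lF := tlift_linear (balk bF).
rewrite (tlift_app _ _ lF); apply: tlift_eq => a b.
rewrite (tlift_app _ _ lF); apply: tlift_eq => c d.
by rewrite tlift_tpair //; apply: balk.
Qed.

Lemma HHoneE M (F : H -> H -> M) : bilin F -> tlift F (HHone H) = F 1 1.
Proof. by move=> bF; rewrite tlift_tpair //; apply: balk. Qed.

Lemma HHflipE M (F : H -> H -> M) (s : HH) : bilin F ->
  tlift F (HHflip s) = \sw_(a, b <- s) F b a.
Proof.
move=> bF; rewrite (tlift_app _ _ (tlift_linear (balk bF))).
by apply: tlift_eq => a b; rewrite tlift_tpair //; apply: balk.
Qed.

Lemma HHmulA (s t u : HH) : HHmul s (HHmul t u) = HHmul (HHmul s t) u.
Proof.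
apply: tensk_ext => M F bF; rewrite HHmulE // [RHS]HHmulE // [RHS]HHmulE; last by blin.
apply: tlift_eq => a b; rewrite HHmulE; last by blin.
by do 2!apply: tlift_eq => ? ?; rewrite !mulrA.
Qed.
Lemma HHmul1 (s : HH) : HHmul (HHone H) s = s.
Proof.
apply: tensk_ext => M F bF; rewrite HHmulE // HHoneE; last by blin.
by apply: tlift_eq => ? ?; rewrite !mul1r.
Qed.
Lemma HHmulr1 (s : HH) : HHmul s (HHone H) = s.
Proof.
apply: tensk_ext => M F bF; rewrite HHmulE //; apply: tlift_eq => a b.
by rewrite HHoneE ?mulr1 //; blin.
Qed.

Lemma RinvE M (F : H -> H -> M) : bilin F -> tlift F Rb = \sw_(x, y <- Rmat H) F y x.
Proof. by move=> bF; rewrite -Rmat_tri HHflipE. Qed.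

Lemma Rinv_cop M (F : H -> H -> M) h : bilin F ->
  \sw_(x, y <- cop h) \sw_(a, b <- Rb) F (x * a) (y * b) =
  \sw_(a, b <- Rb) \sw_(x, y <- cop h) F (a * y) (b * x).
Proof.
move=> bF; have E : HHmul (cop h) Rb = HHmul Rb (HHflip (cop h)).
  by rewrite Rmat_cop -HHmulA HHmulA RinvK HHmul1.
move: (congr1 (tlift F) E); rewrite !HHmulE // => ->.
by apply: tlift_eq => a b; rewrite HHflipE //; blin.
Qed.

Lemma Rinv_copr M (F : H -> H -> H -> M) :
  (forall y z, linear (fun x => F x y z)) -> (forall x z, linear (fun y => F x y z)) ->
  (forall x y, linear (fun z => F x y z)) ->
  \sw_(x, y <- Rb) \sw_(a, b <- cop y) F x a b =
  \sw_(a, b <- Rb) \sw_(c, d <- Rb) F (a * c) b d.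
Proof.
move=> F1 F2 F3.
have F1' (U : lmodType k) (g : U -> H) y z : linear g -> linear (fun x => F (g x) y z).
  by apply: (lin_app (f := fun x => F x y z)).
have F2' (U : lmodType k) (g : U -> H) y z : linear g -> linear (fun x => F y (g x) z).
  by apply: (lin_app (f := fun x => F y x z)).
have F3' (U : lmodType k) (g : U -> H) y z : linear g -> linear (fun x => F y z (g x)).
  by apply: (lin_app (f := fun x => F y z x)).
rewrite RinvE; last by repeat first [lin_step | apply: F1' | apply: F2' | apply: F3'].
pose G a b c := F c a b.
have G1 y z : linear (fun x => G x y z) by apply: F2.
have G2 x z : linear (fun y => G x y z) by apply: F3.
have G3 x y : linear (fun z => G x y z) by apply: F1.
move: (congr1 (tlift3 G) (Rmat_copl H)).
rewrite !(tlift_app _ _ (tlift3_lin G1 G2 G3)).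
under tlift_eq => x y.
  rewrite (tlift_app _ _ (tlift3_lin G1 G2 G3)).
  under tlift_eq => a b do rewrite tlift3_tpair //.
  over.
move=> ->.
under tlift_eq => a b.
  rewrite (tlift_app _ _ (tlift3_lin G1 G2 G3)).
  under tlift_eq => c d do rewrite tlift3_tpair //.
  over.
rewrite [RHS]RinvE; last by repeat first [lin_step | apply: F1' | apply: F2' | apply: F3'].
apply: tlift_eq => a b.
by rewrite [RHS]RinvE //; repeat first [lin_step | apply: F1' | apply: F2' | apply: F3'].
Qed.

Lemma Rinv_copl M (F : H -> H -> H -> M) :
  (forall y z, linear (fun x => F x y z)) -> (forall x z, linear (fun y => F x y z)) ->
  (forall x y, linear (fun z => F x y z)) ->
  \sw_(x, y <- Rb) \sw_(a, b <- cop x) F a b y =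
  \sw_(a, b <- Rb) \sw_(c, d <- Rb) F c a (b * d).
Proof.
move=> F1 F2 F3.
have F1' (U : lmodType k) (g : U -> H) y z : linear g -> linear (fun x => F (g x) y z).
  by apply: (lin_app (f := fun x => F x y z)).
have F2' (U : lmodType k) (g : U -> H) y z : linear g -> linear (fun x => F y (g x) z).
  by apply: (lin_app (f := fun x => F y x z)).
have F3' (U : lmodType k) (g : U -> H) y z : linear g -> linear (fun x => F y z (g x)).
  by apply: (lin_app (f := fun x => F y z x)).
rewrite RinvE; last by repeat first [lin_step | apply: F1' | apply: F2' | apply: F3'].
pose G c a b := F a b c.
have G1 y z : linear (fun x => G x y z) by apply: F3.
have G2 x z : linear (fun y => G x y z) by apply: F1.
have G3 x y : linear (fun z => G x y z) by apply: F2.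
move: (congr1 (tlift3 G) (Rmat_copr H)).
rewrite !(tlift_app _ _ (tlift3_lin G1 G2 G3)).
under tlift_eq => x y.
  rewrite (tlift_app _ _ (tlift3_lin G1 G2 G3)).
  under tlift_eq => a b do rewrite tlift3_tpair //.
  over.
move=> ->.
under tlift_eq => a b.
  rewrite (tlift_app _ _ (tlift3_lin G1 G2 G3)).
  under tlift_eq => c d do rewrite tlift3_tpair //.
  over.
rewrite [RHS]RinvE; last by repeat first [lin_step | apply: F1' | apply: F2' | apply: F3'].
apply: tlift_eq => a b.
by rewrite [RHS]RinvE //; repeat first [lin_step | apply: F1' | apply: F2' | apply: F3'].
Qed.

Lemma Rinv_flip M (F : H -> H -> M) : bilin F ->
  \sw_(t, u <- Rb) \sw_(p, q <- Rb) F (t * q) (u * p) = F 1 1.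
Proof.
move=> bF; rewrite -(HHoneE bF) -RinvK HHmulE //.
by apply: tlift_eq => t u; rewrite RinvE //; blin.
Qed.

Lemma Rinv_coul M (F : H -> M) : linear F -> \sw_(x, y <- Rb) (eps x *: F y) = F 1.
Proof.
move=> lF; pose r := \sw_(x, y <- Rb) (eps x *: y).
have E : HHmul (tpair _ _ 1 r) Rb = Rb.
  apply: tensk_ext => M' G bG.
  rewrite HHmulE // tlift_tpair; last by apply: balk; blin.
  transitivity (\sw_(x, y <- Rb) \sw_(a, b <- cop x) (eps b *: G a y)).
    rewrite Rinv_copl; [|by move=> *; blin..].
    rewrite /r exch_tlift; apply: tlift_eq => c d.
    have lG : linear (fun r => G (1 * c) (r * d)) by blin.
    rewrite (tlift_app _ _ lG); apply: tlift_eq => x y.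
    by rewrite (linZ lG) mul1r.
  by apply: tlift_eq => x y; apply: (counitrE (F := G^~ y)) => //; blin.
have E1 : tpair _ _ 1 r = HHone H.
  by rewrite -[LHS]HHmulr1 -RinvK HHmulA E.
have := congr1 (tlift (fun x y => eps x *: F y)) E1.
have bF : bilin (fun x y => eps x *: F y).
  by split=> ? /=; [apply: lin_scalel; lin | apply: lin_scale].
rewrite HHoneE // tlift_tpair; last by apply: balk.
rewrite cou1 !scale1r => <-; rewrite (tlift_app _ _ lF).
by apply: tlift_eq => x y; rewrite (linZ lF).
Qed.

Lemma Rinv_antiV M (F : H -> H -> M) : bilin F ->
  \sw_(x, y <- Rb) F (T x) y = \sw_(x, y <- Rb) F y x.
Proof.
move=> bF; pose Q : HH := \sw_(x, y <- Rb) tpair _ _ (T x) y.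
have QE M' (G : H -> H -> M') : bilin G -> tlift G Q = \sw_(x, y <- Rb) G (T x) y.
  move=> bG; rewrite (tlift_app _ _ (tlift_linear (balk bG))).
  by apply: tlift_eq => a b; rewrite tlift_tpair //; apply: balk.
have E : HHmul Q Rb = HHone H.
  apply: tensk_ext => M' G bG; rewrite HHmulE // QE; last by blin.
  rewrite HHoneE //.
  transitivity (\sw_(x, y <- Rb) (eps x *: G 1 y)); last first.
    by rewrite (Rinv_coul (F := fun y => G 1 y)) //; blin.
  transitivity (\sw_(x, y <- Rb) \sw_(a, b <- cop x) G (T b * a) y).
    by rewrite Rinv_copl //; move=> *; blin.
  by apply: tlift_eq => x y; apply: (antiVlE (F := G^~ y)) => //; blin.
have EQ : Q = Rmat H by rewrite -[Q]HHmulr1 -RinvK HHmulA E HHmul1.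
rewrite -QE // EQ [RHS]RinvE //.
by split=> ? /=; blin.
Qed.
End RmatTheory.

(* Braided commutative left module algebras over a triangular Hopf algebra. *)
Record bcModAlg (k : comUnitRingType) (H : triHopf k) := BcModAlg {
  bc_alg :> algType k;
  act : H -> bc_alg -> bc_alg;
  act_bilin : bilin act;
  actM : forall g h a, act (g * h) a = act g (act h a);
  act1 : forall a, act 1 a = a;
  act_mul : forall h a b, act h (a * b) = \sw_(x, y <- cop h) (act x a * act y b);
  act_unit : forall h, act h 1 = (cou h : k) *: 1;
  act_bc : forall a b, a * b = \sw_(x, y <- Rinv H) (act x b * act y a)
}.

(* Symmetric equivariant bimodules: la, ra are the left and right actions of A,
   ha that of H. *)
Record sbimod (k : comUnitRingType) (H : triHopf k) (A : bcModAlg H) := SBimod {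
  sb_mod :> lmodType k;
  la : A -> sb_mod -> sb_mod;
  ra : sb_mod -> A -> sb_mod;
  ha : H -> sb_mod -> sb_mod;
  la_bilin : bilin la;
  ra_bilin : bilin ra;
  ha_bilin : bilin ha;
  laA : forall a b v, la (a * b) v = la a (la b v);
  la1 : forall v, la 1 v = v;
  raA : forall v a b, ra v (a * b) = ra (ra v a) b;
  ra1 : forall v, ra v 1 = v;
  laraA : forall a v b, la a (ra v b) = ra (la a v) b;
  haM : forall g h v, ha (g * h) v = ha g (ha h v);
  ha1 : forall v, ha 1 v = v;
  ha_la : forall h a v, ha h (la a v) = \sw_(x, y <- cop h) la (act x a) (ha y v);
  ha_ra : forall h v a, ha h (ra v a) = \sw_(x, y <- cop h) ra (ha x v) (act y a);
  la_sym : forall a v, la a v = \sw_(x, y <- Rinv H) ra (ha x v) (act y a)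
}.

Section LinMod.
Variables (k : comUnitRingType) (H : triHopf k) (A : bcModAlg H).
Lemma lin_actl (U : lmodType k) (g : U -> H) (a : A) : linear g ->
  linear (fun x => act (g x) a).
Proof. by apply: lin_binl; apply: act_bilin. Qed.
Lemma lin_actr (U : lmodType k) (g : U -> A) h : linear g ->
  linear (fun x => act h (g x)).
Proof. by apply: lin_binr; apply: act_bilin. Qed.
Variable V : sbimod A.
Lemma lin_lal (U : lmodType k) (g : U -> A) (v : V) : linear g ->
  linear (fun x => la (g x) v).
Proof. by apply: lin_binl; apply: la_bilin. Qed.
Lemma lin_lar (U : lmodType k) (g : U -> V) a : linear g ->
  linear (fun x => la a (g x)).
Proof. by apply: lin_binr; apply: la_bilin. Qed.
Lemma lin_ral (U : lmodType k) (g : U -> V) a : linear g ->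
  linear (fun x => ra (g x) a).
Proof. by apply: lin_binl; apply: ra_bilin. Qed.
Lemma lin_rar (U : lmodType k) (g : U -> A) (v : V) : linear g ->
  linear (fun x => ra v (g x)).
Proof. by apply: lin_binr; apply: ra_bilin. Qed.
Lemma lin_hal (U : lmodType k) (g : U -> H) (v : V) : linear g ->
  linear (fun x => ha (g x) v).
Proof. by apply: lin_binl; apply: ha_bilin. Qed.
Lemma lin_har (U : lmodType k) (g : U -> V) h : linear g ->
  linear (fun x => ha h (g x)).
Proof. by apply: lin_binr; apply: ha_bilin. Qed.
Lemma act_lin h : linear (@act k H A h). Proof. by case: (act_bilin A). Qed.
Lemma la_lin a : linear (@la k H A V a). Proof. by case: (la_bilin V). Qed.
Lemma ha_lin h : linear (@ha k H A V h). Proof. by case: (ha_bilin V). Qed.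
Lemma ra_lin a : linear (fun v => @ra k H A V v a).
Proof. by case: (ra_bilin V) => + _; exact. Qed.
End LinMod.
Ltac lin_more ::= first
  [ apply: lin_cop | apply: lin_cou | apply: lin_anti | apply: lin_antiV
  | apply: lin_actl | apply: lin_actr | apply: lin_lal | apply: lin_lar
  | apply: lin_ral | apply: lin_rar | apply: lin_hal | apply: lin_har ].

(* A left H-equivariant A-module whose right action is given by the braiding
   is a symmetric H-equivariant A-bimodule. *)
Section MkSBimod.
Variables (k : comUnitRingType) (H : triHopf k) (A : bcModAlg H) (V : lmodType k).
Variables (la : A -> V -> V) (ra : V -> A -> V) (ha : H -> V -> V).
Hypothesis la_bilin : bilin la.
Hypothesis ha_bilin : bilin ha.
Hypothesis laA : forall a b v, la (a * b) v = la a (la b v).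
Hypothesis la1 : forall v, la 1 v = v.
Hypothesis haM : forall g h v, ha (g * h) v = ha g (ha h v).
Hypothesis ha1 : forall v, ha 1 v = v.
Hypothesis ha_la : forall h a v,
  ha h (la a v) = \sw_(x, y <- cop h) la (act x a) (ha y v).
Hypothesis raE : forall v a, ra v a = \sw_(x, y <- Rinv H) la (act x a) (ha y v).

Let lal (U : lmodType k) (g : U -> A) (v : V) : linear g ->
  linear (fun x => la (g x) v).
Proof. exact: lin_binl. Qed.
Let lar (U : lmodType k) (g : U -> V) a : linear g ->
  linear (fun x => la a (g x)).
Proof. exact: lin_binr. Qed.
Let hal (U : lmodType k) (g : U -> H) (v : V) : linear g ->
  linear (fun x => ha (g x) v).
Proof. exact: lin_binl. Qed.
Let har (U : lmodType k) (g : U -> V) h : linear g ->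
  linear (fun x => ha h (g x)).
Proof. exact: lin_binr. Qed.
Ltac mlin := repeat first [lin_step | apply: lal | apply: lar | apply: hal | apply: har].

Let ra_bilin : bilin ra.
Proof.
split=> [a c u v|v c a b]; rewrite !raE.
  by apply: (_ : linear (fun v => \sw_(x, y <- Rinv H) la (act x a) (ha y v))); mlin.
by apply: (_ : linear (fun a => \sw_(x, y <- Rinv H) la (act x a) (ha y v))); mlin.
Qed.

Let ra_la v a b : ra (la b v) a = la b (ra v a).
Proof.
rewrite !raE.
transitivity (\sw_(x, y <- Rinv H) \sw_(c, d <- cop y) la (act x a * act c b) (ha d v)).
  apply: tlift_eq => x y; rewrite ha_la (tlift_app _ _ (lar _ lin_id)).
  by apply: tlift_eq => c d; rewrite laA.
rewrite Rinv_copr; [|by move=> *; mlin..].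
transitivity (\sw_(c, d <- Rinv H) la (b * act c a) (ha d v)).
  rewrite exch_tlift; apply: tlift_eq => c d.
  rewrite act_bc (tlift_app _ _ (f := fun b => la b (ha d v))); last by mlin.
  by apply: tlift_eq => x y; rewrite actM.
rewrite (tlift_app _ _ (lar _ lin_id)).
by apply: tlift_eq => x y; rewrite laA.
Qed.

Let ra1 v : ra v 1 = v.
Proof.
rewrite raE -[RHS]ha1 -(Rinv_coul (F := fun y => ha y v)); last by mlin.
by apply: tlift_eq => x y; rewrite act_unit (linZ (lal _ lin_id)) la1.
Qed.

Let raA v a b : ra v (a * b) = ra (ra v a) b.
Proof.
rewrite [in RHS](raE v a) [RHS](tlift_app _ _ (f := ra^~ b)); last by case: ra_bilin.
transitivity (\sw_(r, s <- Rinv H) \sw_(p, q <- Rinv H) la (act r a * act p b)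
   (ha q (ha s v))); last first.
  apply: tlift_eq => r s; rewrite ra_la raE (tlift_app _ _ (lar _ lin_id)).
  by apply: tlift_eq => p q; rewrite laA.
rewrite exch_tlift raE.
transitivity (\sw_(x, y <- Rinv H) \sw_(c, d <- cop x) la (act c a * act d b) (ha y v)).
  apply: tlift_eq => x y; rewrite act_mul.
  by rewrite (tlift_app _ _ (f := fun b => la b (ha y v))) //; mlin.
rewrite Rinv_copl; [|by move=> *; mlin..].
by do 2!apply: tlift_eq => ? ?; rewrite haM.
Qed.

Let ha_ra h v a : ha h (ra v a) = \sw_(x, y <- cop h) ra (ha x v) (act y a).
Proof.
rewrite raE (tlift_app _ _ (har _ lin_id)).
transitivity (\sw_(x, y <- cop h) \sw_(c, d <- Rinv H) la (act (x * c) a) (ha (y * d) v)).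
  rewrite exch_tlift; apply: tlift_eq => c d; rewrite ha_la.
  by apply: tlift_eq => x y; rewrite actM haM.
rewrite (Rinv_cop (F := fun x y => la (act x a) (ha y v))); last by mlin.
rewrite exch_tlift; apply: tlift_eq => x y; rewrite raE.
by apply: tlift_eq => c d; rewrite actM haM.
Qed.

Let la_sym a v : la a v = \sw_(x, y <- Rinv H) ra (ha x v) (act y a).
Proof.
transitivity (\sw_(p, q <- Rinv H) \sw_(t, u <- Rinv H) la (act (t * q) a) (ha (u * p) v)).
  rewrite exch_tlift (Rinv_flip (F := fun x y => la (act x a) (ha y v))); last by mlin.
  by rewrite act1 ha1.
apply: tlift_eq => p q; rewrite raE; apply: tlift_eq => t u.
by rewrite actM haM.
Qed.

Let laraA a v b : la a (ra v b) = ra (la a v) b. Proof. by rewrite ra_la. Qed.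

Definition mk_sbimod : sbimod A :=
  SBimod la_bilin ra_bilin ha_bilin laA la1 raA ra1 laraA haM ha1 ha_la ha_ra la_sym.
End MkSBimod.

Section SBimodTheory.
Variables (k : comUnitRingType) (H : triHopf k) (A : bcModAlg H).
Notation Rb := (Rinv H).

Lemma raE (V : sbimod A) (v : V) a : ra v a = \sw_(x, y <- Rb) la (act x a) (ha y v).
Proof.
transitivity (\sw_(p, q <- Rb) \sw_(t, u <- Rb) ra (ha (t * q) v) (act (u * p) a)).
  rewrite exch_tlift (Rinv_flip (F := fun x y => ra (ha x v) (act y a))); last by lin.
  by rewrite act1 ha1.
apply: tlift_eq => p q; rewrite la_sym; apply: tlift_eq => t u.
by rewrite actM haM.
Qed.

Lemma regular_bilin : bilin (fun a b : A => a * b). Proof. by lin. Qed.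
Definition regular : sbimod A :=
  mk_sbimod (V := A) (ra := fun a b => a * b) (ha := @act _ _ A)
    regular_bilin (act_bilin A) (fun a b c => esym (mulrA a b c)) (@mul1r A)
    (@actM _ _ A) (@act1 _ _ A) (@act_mul _ _ A) (@act_bc _ _ A).

Section TensorBimod.
Variables V W : sbimod A.
Notation VW := (tens (@ra _ _ _ V) (@la _ _ _ W)).
Notation tp := (tpair (@ra _ _ _ V) (@la _ _ _ W)).

Definition tens_la (a : A) (t : VW) : VW := \sw_(v, w <- t) tp (la a v) w.
Definition tens_ra (t : VW) (a : A) : VW := \sw_(v, w <- t) tp v (ra w a).
Definition tens_ha (h : H) (t : VW) : VW :=
  \sw_(v, w <- t) \sw_(x, y <- cop h) tp (ha x v) (ha y w).

Lemma tens_la_bal a : balanced (@ra _ _ _ V) (@la _ _ _ W) (fun v w => tp (la a v) w).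
Proof. by split=> [w|v|v b w]; [lin|lin|rewrite laraA tpair_bal]. Qed.
Lemma tens_ra_bal a : balanced (@ra _ _ _ V) (@la _ _ _ W) (fun v w => tp v (ra w a)).
Proof. by split=> [w|v|v b w]; [lin|lin|rewrite -laraA tpair_bal]. Qed.
Lemma tens_ha_bal h : balanced (@ra _ _ _ V) (@la _ _ _ W)
  (fun v w => \sw_(x, y <- cop h) tp (ha x v) (ha y w)).
Proof.
split=> [w|v|v b w]; [by lin|by lin|].
transitivity (\sw_(x, y <- cop h) \sw_(c, d <- cop x)
    tp (ra (ha c v) (act d b)) (ha y w)).
  apply: tlift_eq => x y; rewrite ha_ra (tlift_app _ _ (f := fun z => tp z (ha y w))) //.
  by lin.
rewrite (coassocE (F := fun c d y => tp (ra (ha c v) (act d b)) (ha y w)));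
  [|by move=> *; lin..].
apply: tlift_eq => x y; rewrite ha_la (tlift_app _ _ (f := tp (ha x v))); last by lin.
by apply: tlift_eq => c d; rewrite tpair_bal.
Qed.

Lemma tens_laE a v w : tens_la a (tp v w) = tp (la a v) w.
Proof. by rewrite /tens_la tlift_tpair //; apply: tens_la_bal. Qed.
Lemma tens_raE a v w : tens_ra (tp v w) a = tp v (ra w a).
Proof. by rewrite /tens_ra tlift_tpair //; apply: tens_ra_bal. Qed.
Lemma tens_haE h v w : tens_ha h (tp v w) = \sw_(x, y <- cop h) tp (ha x v) (ha y w).
Proof. by rewrite /tens_ha tlift_tpair //; apply: tens_ha_bal. Qed.

Lemma tens_la_bilin : bilin tens_la.
Proof.
split=> [t|a]; first by rewrite /tens_la; lin.
exact: (tlift_linear (tens_la_bal a)).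
Qed.
Lemma tens_ha_bilin : bilin tens_ha.
Proof.
split=> [t|a]; first by rewrite /tens_ha; lin.
exact: (tlift_linear (tens_ha_bal a)).
Qed.
Lemma tens_ra_lin a : linear (tens_ra^~ a).
Proof. exact: (tlift_linear (tens_ra_bal a)). Qed.

Let lla a : linear (tens_la a). Proof. by case: tens_la_bilin. Qed.
Let lha h : linear (tens_ha h). Proof. by case: tens_ha_bilin. Qed.

Lemma tens_laA a b t : tens_la (a * b) t = tens_la a (tens_la b t).
Proof.
apply: (tens_lin_ext (f := tens_la (a * b)) (g := fun t => tens_la a (tens_la b t))) => //.
  by apply: lin_app; apply: lla.
by move=> v w; rewrite !tens_laE laA.
Qed.
Lemma tens_la1 t : tens_la 1 t = t.
Proof.
apply: (tens_lin_ext (f := tens_la 1) (g := id)) => //.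
by move=> v w; rewrite !tens_laE la1.
Qed.
Lemma tens_haM g h t : tens_ha (g * h) t = tens_ha g (tens_ha h t).
Proof.
apply: (tens_lin_ext (f := tens_ha (g * h)) (g := fun t => tens_ha g (tens_ha h t))) => //.
  by apply: lin_app; apply: lha.
move=> v w; rewrite !tens_haE (tlift_app _ _ (lha g)).
rewrite (copME (F := fun x y => tp (ha x v) (ha y w))); last by lin.
rewrite exch_tlift; apply: tlift_eq => c d; rewrite tens_haE.
by apply: tlift_eq => a b; rewrite !haM.
Qed.
Lemma tens_ha1 t : tens_ha 1 t = t.
Proof.
apply: (tens_lin_ext (f := tens_ha 1) (g := id)) => //.
by move=> v w; rewrite !tens_haE cop1E ?ha1 //; lin.
Qed.
Lemma tens_ha_la h a t :
  tens_ha h (tens_la a t) = \sw_(x, y <- cop h) tens_la (act x a) (tens_ha y t).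
Proof.
apply: (tens_lin_ext (f := fun t => tens_ha h (tens_la a t))
  (g := fun t => \sw_(x, y <- cop h) tens_la (act x a) (tens_ha y t))).
- by apply: lin_app; [apply: lha | apply: lla].
- by apply: lin_tliftc => x y; apply: lin_app; [apply: lla | apply: lha].
move=> v w; rewrite tens_laE tens_haE.
transitivity (\sw_(x, y <- cop h) \sw_(c, d <- cop x) tp (la (act c a) (ha d v)) (ha y w)).
  apply: tlift_eq => x y; rewrite ha_la (tlift_app _ _ (f := fun z => tp z (ha y w))) //.
  by lin.
rewrite (coassocE (F := fun c d y => tp (la (act c a) (ha d v)) (ha y w)));
  [|by move=> *; lin..].
apply: tlift_eq => x y; rewrite tens_haE (tlift_app _ _ (lla _)).
by apply: tlift_eq => c d; rewrite tens_laE.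
Qed.
Lemma tens_raE' t a :
  tens_ra t a = \sw_(x, y <- Rb) tens_la (act x a) (tens_ha y t).
Proof.
apply: (tens_lin_ext (f := tens_ra^~ a)
  (g := fun t => \sw_(x, y <- Rb) tens_la (act x a) (tens_ha y t))).
- exact: tens_ra_lin.
- by apply: lin_tliftc => x y; apply: lin_app; [apply: lla | apply: lha].
move=> v w; rewrite tens_raE raE (tlift_app _ _ (f := tp v)); last by lin.
transitivity (\sw_(x, y <- Rb) \sw_(p, q <- cop y) tp (la (act x a) (ha p v)) (ha q w));
  last first.
  apply: tlift_eq => x y; rewrite tens_haE (tlift_app _ _ (lla _)).
  by apply: tlift_eq => c d; rewrite tens_laE.
rewrite Rinv_copr; [|by move=> *; lin..].
rewrite exch_tlift; apply: tlift_eq => x y; rewrite -tpair_bal raE.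
rewrite (tlift_app _ _ (f := fun z => tp z (ha y w))); last by lin.
by apply: tlift_eq => c d; rewrite actM.
Qed.

Definition tensor : sbimod A :=
  mk_sbimod (V := VW) (ra := tens_ra) tens_la_bilin tens_ha_bilin tens_laA tens_la1
    tens_haM tens_ha1 tens_ha_la tens_raE'.
Definition ten (v : V) (w : W) : tensor := tp v w.
End TensorBimod.
End SBimodTheory.

Record submodule (k : comUnitRingType) (E : lmodType k) := Submodule {
  sm_mem : pred E;
  sm_closed : submod_closed sm_mem
}.

Lemma mk_closed (k : comUnitRingType) (E : lmodType k) (P : E -> Prop) :
  P 0 -> (forall c u v, P u -> P v -> P (c *: u + v)) ->
  submod_closed (fun u => `[< P u >]).
Proof.
move=> P0 PD; split; first exact/asboolP.
by move=> c u v /asboolP Pu /asboolP Pv; apply/asboolP; apply: PD.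
Qed.

Definition sm_type (k : comUnitRingType) (E : lmodType k) (D : submodule E) : Type :=
  {u : E | sm_mem D u}.

Section Submodule.
Variables (k : comUnitRingType) (E : lmodType k) (D : submodule E).
HB.instance Definition _ := [isSub of sm_type D for @sval E (sm_mem D)].
HB.instance Definition _ := [Choice of sm_type D by <:].
HB.instance Definition _ :=
  GRing.SubChoice_isSubLmodule.Build k E (sm_mem D) (sm_type D) (sm_closed D).
Definition sm_mk u (Pu : sm_mem D u) : sm_type D := exist _ u Pu.
Lemma sm_lin : linear (fun u : sm_type D => \val u). Proof. by []. Qed.
Lemma sm_inj : injective (fun u : sm_type D => \val u). Proof. exact: val_inj. Qed.
End Submodule.

Section Fct.
Variables (k : comUnitRingType) (T : Type) (M : lmodType k).
Lemma fctD (f g : T -> M) x : (f + g) x = f x + g x. Proof. by []. Qed.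
Lemma fctZ c (f : T -> M) x : (c *: f) x = c *: f x. Proof. by []. Qed.
Lemma fct_eval_lin x : linear (fun f : T -> M => f x). Proof. by []. Qed.
End Fct.

Section Hom.
Variables (k : comUnitRingType) (H : triHopf k) (A : bcModAlg H).

Definition left_linear (V W : sbimod A) (f : V -> W) : Prop :=
  linear f /\ forall a v, f (la a v) = la a (f v).

Lemma left_linear_closed (V W : sbimod A) :
  submod_closed (fun f : V -> W => `[< left_linear f >]).
Proof.
apply: mk_closed.
  by split=> [c u v|a v] /=; rewrite ?scaler0 ?addr0 // ?(lin0 (@la_lin _ _ _ _ a)).
move=> c f g [lf Af] [lg Ag]; split=> [d u v|a v]; rewrite !fctD !fctZ.
  by rewrite lf lg !scalerDr addrACA !scalerA mulrC.
by rewrite Af Ag (linD (@la_lin _ _ _ _ a)) (linZ (@la_lin _ _ _ _ a)).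
Qed.
Definition hom_sub (V W : sbimod A) : submodule (V -> W) := Submodule (@left_linear_closed V W).
Definition hom (V W : sbimod A) : lmodType k := sm_type (hom_sub V W).

Section HomBimod.
Variables V W : sbimod A.
Notation T := (@antiV k H).
Notation Rb := (Rinv H).
Definition happ (L : hom V W) : V -> W := \val L.
Lemma happ_ll (L : hom V W) : left_linear (happ L).
Proof. by apply/asboolP; exact: (valP L). Qed.
Lemma happ_lin (L : hom V W) : linear (happ L). Proof. by case: (happ_ll L). Qed.
Lemma happ_la (L : hom V W) a v : happ L (la a v) = la a (happ L v).
Proof. by case: (happ_ll L). Qed.
Lemma happ_linl v : linear (happ^~ v). Proof. by []. Qed.
Lemma happP c (L M : hom V W) v : happ (c *: L + M) v = c *: happ L v + happ M v.
Proof. by []. Qed.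
Lemma hom_ext (L M : hom V W) : happ L =1 happ M -> L = M.
Proof. by move=> E; apply: val_inj; apply/funext. Qed.
Definition mk_hom f (lf : left_linear f) : hom V W := sm_mk (D := hom_sub V W) (asboolT lf).
Lemma mk_homE f (lf : left_linear f) : happ (mk_hom lf) = f. Proof. by []. Qed.

Let lhapp (U : lmodType k) (g : U -> V) L : linear g -> linear (fun x => happ L (g x)).
Proof. by apply: lin_app; apply: happ_lin. Qed.
Let lhappl (U : lmodType k) (g : U -> hom V W) v : linear g ->
  linear (fun x => happ (g x) v).
Proof. by move=> lg c x y; rewrite lg. Qed.
Ltac hlin := repeat first [lin_step | apply: lhapp | apply: lhappl].

Lemma hom_la_ll a (L : hom V W) : left_linear (fun v => happ L (ra v a)).
Proof.
split=> [|b v]; first by hlin.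
by rewrite -laraA happ_la.
Qed.
Definition hom_la a L : hom V W := mk_hom (hom_la_ll a L).

Lemma hom_ra_ll (L : hom V W) a : left_linear (fun v => ra (happ L v) a).
Proof.
split=> [|b v]; first by hlin.
by rewrite happ_la laraA.
Qed.
Definition hom_ra L a : hom V W := mk_hom (hom_ra_ll L a).

(* The action of H by h |>^cop L = h_(2) |> o L o S^-1(h_(1)) |> *)
Definition hom_hafun h (L : hom V W) v : W :=
  \sw_(x, y <- cop h) ha y (happ L (ha (T x) v)).

Lemma hom_ha_ll h (L : hom V W) : left_linear (hom_hafun h L).
Proof.
split=> [|a v]; first by rewrite /hom_hafun; hlin.
pose G c d y := \sw_(e, f <- cop y) la (act (e * T d) a) (ha f (happ L (ha (T c) v))).
have G1 y z : linear (fun x => G x y z) by rewrite /G; hlin.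
have G2 y z : linear (fun x => G y x z) by rewrite /G; hlin.
have G3 y z : linear (fun x => G y z x) by rewrite /G; hlin.
transitivity (\sw_(x, y <- cop h) \sw_(c, d <- cop x) G c d y).
  apply: tlift_eq => x y; rewrite ha_la.
  rewrite (antiV_cop (F := fun p q => la (act p a) (ha q v))); last by hlin.
  rewrite (tlift_app _ _ (lhapp _ lin_id)) (tlift_app _ _ (@ha_lin _ _ _ _ _)).
  apply: tlift_eq => c d; rewrite happ_la ha_la.
  by apply: tlift_eq => e f; rewrite actM.
rewrite coassocE // /hom_hafun (tlift_app _ _ (@la_lin _ _ _ _ _)).
apply: tlift_eq => c z.
transitivity (\sw_(p, f <- cop z) \sw_(d, e <- cop p)
    la (act (e * T d) a) (ha f (happ L (ha (T c) v)))).
  by rewrite (coassocE (F := fun d e f =>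
    la (act (e * T d) a) (ha f (happ L (ha (T c) v))))) //; move=> *; hlin.
apply: (counitlE (F := fun f => la a (ha f (happ L (ha (T c) v))))); first by hlin.
move=> p f.
apply: (antiVrE (F := fun u => la (act u a) (ha f (happ L (ha (T c) v))))) => //.
  by hlin.
by rewrite act1.
Qed.
Definition hom_ha h L : hom V W := mk_hom (hom_ha_ll h L).
Lemma hom_haE h L v : happ (hom_ha h L) v = \sw_(x, y <- cop h) ha y (happ L (ha (T x) v)).
Proof. by []. Qed.

Lemma hom_laE a L v : happ (hom_la a L) v = happ L (ra v a).
Proof. by []. Qed.
Lemma hom_raE' L a v : happ (hom_ra L a) v = ra (happ L v) a.
Proof. by []. Qed.

Lemma hom_la_bilin : bilin hom_la.
Proof.
split=> [L c a b|a c L M]; apply: hom_ext => v; rewrite happP //.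
by apply: (_ : linear (fun a => happ L (ra v a))); hlin.
Qed.
Lemma hom_ha_bilin : bilin hom_ha.
Proof.
split=> [L c a b|a c L M]; apply: hom_ext => v; rewrite happP.
  by apply: (_ : linear (fun h => hom_hafun h L v)); rewrite /hom_hafun; hlin.
by apply: (_ : linear (fun L => hom_hafun a L v)); rewrite /hom_hafun; hlin.
Qed.
Lemma hom_ra_bilin : bilin hom_ra.
Proof.
split=> [a c L M|L c a b]; apply: hom_ext => v; rewrite happP.
  exact: (@ra_lin _ _ _ W a).
by apply: (_ : linear (fun a => ra (happ L v) a)); hlin.
Qed.
Lemma hom_laA a b L : hom_la (a * b) L = hom_la a (hom_la b L).
Proof. by apply: hom_ext => v; rewrite /= /happ /= -/(happ L) raA. Qed.
Lemma hom_la1 L : hom_la 1 L = L.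
Proof. by apply: hom_ext => v; rewrite mk_homE ra1. Qed.
Lemma hom_haM g h L : hom_ha (g * h) L = hom_ha g (hom_ha h L).
Proof.
apply: hom_ext => v; rewrite !hom_haE.
rewrite (copME (F := fun x y => ha y (happ L (ha (T x) v)))); last by hlin.
apply: tlift_eq => a b; rewrite hom_haE (tlift_app _ _ (@ha_lin _ _ _ _ _)).
by apply: tlift_eq => c d; rewrite antiVM !haM.
Qed.
Lemma hom_ha1 L : hom_ha 1 L = L.
Proof.
by apply: hom_ext => v; rewrite hom_haE cop1E ?antiV1 ?ha1 //; hlin.
Qed.
Lemma hom_ha_la h a L :
  hom_ha h (hom_la a L) = \sw_(x, y <- cop h) hom_la (act x a) (hom_ha y L).
Proof.
apply: hom_ext => v; rewrite [RHS](tlift_app _ _ (happ_linl v)) hom_haE mk_homE.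
pose G d q := ha q (happ L (ra (ha (T d) v) a)).
transitivity (tlift G (cop h)) => //.
pose K x c z := \sw_(d, q <- cop z) ha q (happ L (ra (ha (T d) v) (act (T c * x) a))).
have K1 y z : linear (fun x => K x y z) by rewrite /K; hlin.
have K2 y z : linear (fun x => K y x z) by rewrite /K; hlin.
have K3 y z : linear (fun x => K y z x) by rewrite /K; hlin.
transitivity (\sw_(w, z <- cop h) \sw_(x, c <- cop w) K x c z).
  symmetry; apply: (counitlE (F := fun z => tlift G (cop z))).
    by rewrite /G; hlin.
  move=> w z; apply: (antiVlE (F := fun u =>
    \sw_(d, q <- cop z) ha q (happ L (ra (ha (T d) v) (act u a))))) => //.
    by hlin.
  by apply: tlift_eq => d q; rewrite act1.
rewrite coassocE //; apply: tlift_eq => x y; rewrite hom_laE hom_haE.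
transitivity (\sw_(p, q <- cop y) \sw_(c, d <- cop p)
    ha q (happ L (ra (ha (T d) v) (act (T c * x) a)))).
  by rewrite (coassocE (F := fun c d q =>
    ha q (happ L (ra (ha (T d) v) (act (T c * x) a))))) //; move=> *; hlin.
apply: tlift_eq => p q; rewrite ha_ra.
rewrite (antiV_cop (F := fun u w => ra (ha u v) (act w (act x a)))); last by hlin.
rewrite (tlift_app _ _ (lhapp _ lin_id)) (tlift_app _ _ (@ha_lin _ _ _ _ _)).
by apply: tlift_eq => c d; rewrite actM.
Qed.

Lemma hom_la_sym a L : hom_la a L = \sw_(x, y <- Rb) hom_ra (hom_ha x L) (act y a).
Proof.
apply: hom_ext => v; rewrite [RHS](tlift_app _ _ (happ_linl v)) mk_homE.
rewrite raE.
transitivity (\sw_(x, y <- Rb) la (act y a) (happ L (ha (T x) v))).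
  rewrite (Rinv_antiV (F := fun x y => la (act y a) (happ L (ha x v)))); last by hlin.
  rewrite (tlift_app _ _ (lhapp _ lin_id)).
  by apply: tlift_eq => x y; rewrite happ_la.
symmetry.
transitivity (\sw_(x, y <- Rb) \sw_(p, q <- cop x)
    ra (ha q (happ L (ha (T p) v))) (act y a)).
  apply: tlift_eq => x y; rewrite mk_homE hom_haE.
  by rewrite (tlift_app _ _ (@ra_lin _ _ _ _ _)).
rewrite (Rinv_copl (F := fun p q y => ra (ha q (happ L (ha (T p) v))) (act y a)));
  [|by move=> *; hlin..].
rewrite exch_tlift; apply: tlift_eq => c d; rewrite la_sym.
by apply: tlift_eq => x y; rewrite actM.
Qed.

Lemma hom_raE L a : hom_ra L a = \sw_(x, y <- Rb) hom_la (act x a) (hom_ha y L).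
Proof.
transitivity (\sw_(p, q <- Rb) \sw_(t, u <- Rb)
    hom_ra (hom_ha (t * q) L) (act (u * p) a)).
  rewrite exch_tlift (Rinv_flip (F := fun x y => hom_ra (hom_ha x L) (act y a))).
    by rewrite act1 hom_ha1.
  split=> h /=.
    by apply: (lin_binl _ hom_ra_bilin); apply: (lin_binl _ hom_ha_bilin); lin.
  by apply: (lin_binr _ hom_ra_bilin); lin.
apply: tlift_eq => p q; rewrite hom_la_sym; apply: tlift_eq => t u.
by rewrite actM hom_haM.
Qed.

Definition hom_bimod : sbimod A :=
  mk_sbimod (V := hom V W) (ra := hom_ra) hom_la_bilin hom_ha_bilin hom_laA hom_la1
    hom_haM hom_ha1 hom_ha_la hom_raE.
End HomBimod.
End Hom.

Section BraidedDer.
Variables (k : comUnitRingType) (H : triHopf k) (A : bcModAlg H).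
Notation S := (@anti k H).
Notation Rb := (Rinv H).
Implicit Types (u v : A -> A).

Lemma cop4 (M : lmodType k) (F : H -> H -> H -> H -> M) h :
  (forall b c d, linear (fun a => F a b c d)) ->
  (forall a c d, linear (fun b => F a b c d)) ->
  (forall a b d, linear (fun c => F a b c d)) ->
  (forall a b c, linear (fun d => F a b c d)) ->
  \sw_(x, y <- cop h) \sw_(a, b <- cop x) \sw_(c, d <- cop y) F a b c d =
  \sw_(a, z <- cop h) \sw_(w, d <- cop z) \sw_(b, c <- cop w) F a b c d.
Proof.
move=> F1 F2 F3 F4.
have F3' (U : lmodType k) (g : U -> H) a b d : linear g -> linear (fun x => F a b (g x) d).
  by apply: (lin_app (f := fun x => F a b x d)).
have F4' (U : lmodType k) (g : U -> H) a b c : linear g -> linear (fun x => F a b c (g x)).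
  by apply: (lin_app (f := F a b c)).
rewrite (coassocE (F := fun a b y => \sw_(c, d <- cop y) F a b c d)).
- apply: tlift_eq => a z.
  by rewrite (coassocE (F := fun b c d => F a b c d)).
- by move=> b y; lin.
- by move=> b y; lin.
- by move=> b y; repeat first [lin_step | apply: F3' | apply: F4'].
Qed.

(* (h |> u)(a) = h_(1) |> u(S(h_(2)) |> a) *)
Definition endo_ha (h : H) u : A -> A :=
  fun a => \sw_(x, y <- cop h) act x (u (act (S y) a)).

Definition braided_der u : Prop :=
  linear u /\ forall a b,
    u (a * b) = u a * b + \sw_(x, y <- Rb) (act x a * endo_ha y u b).

Lemma lin_endol (U : lmodType k) (g : U -> H) u a : linear u -> linear g ->
  linear (fun x => endo_ha (g x) u a).
Proof.
move=> lu lg.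
have lu' (U' : lmodType k) (f : U' -> A) : linear f -> linear (fun x => u (f x)).
  exact: lin_app.
by apply: lin_tlift => //; repeat first [lin_step | apply: lu'].
Qed.
Lemma lin_endor (U : lmodType k) (g : U -> A) u h : linear u -> linear g ->
  linear (fun x => endo_ha h u (g x)).
Proof.
move=> lu lg.
have lu' (U' : lmodType k) (f : U' -> A) : linear f -> linear (fun x => u (f x)).
  exact: lin_app.
by rewrite /endo_ha; repeat first [lin_step | apply: lu'].
Qed.
Lemma lin_endom (U : lmodType k) (g : U -> A -> A) h a : linear g ->
  linear (fun x => endo_ha h (g x) a).
Proof.
move=> lg c x y; rewrite /endo_ha lg.
by apply: (_ : linear (fun u => endo_ha h u a)) => {c x y} c x y; rewrite /endo_ha;
  rewrite /tlift scaler_sumr -big_split; apply: eq_bigr => p _; rewrite act_lin.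
Qed.

Lemma endo_lin h u : linear u -> linear (endo_ha h u).
Proof. by move=> lu; apply: lin_endor. Qed.

Lemma endo_haM g h u : linear u -> endo_ha (g * h) u = endo_ha g (endo_ha h u).
Proof.
move=> lu; apply/funext => z; rewrite /endo_ha.
have lu' (U' : lmodType k) (f : U' -> A) : linear f -> linear (fun x => u (f x)).
  exact: lin_app.
rewrite (copME (F := fun x y => act x (u (act (S y) z)))); last first.
  by repeat first [lin_step | apply: lu'].
apply: tlift_eq => a b; rewrite (tlift_app _ _ (@act_lin _ _ _ _)).
by apply: tlift_eq => c d; rewrite antiM !actM.
Qed.
Lemma endo_ha1 u : linear u -> endo_ha 1 u = u.
Proof.
move=> lu; apply/funext => z; rewrite /endo_ha cop1E ?anti1 ?act1 //.
have lu' (U' : lmodType k) (f : U' -> A) : linear f -> linear (fun x => u (f x)).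
  exact: lin_app.
by repeat first [lin_step | apply: lu'].
Qed.

Definition endo_la (a : A) u : A -> A := fun b => a * u b.
Lemma endo_ha_la h a u b : linear u ->
  endo_ha h (endo_la a u) b = \sw_(x, y <- cop h) (act x a * endo_ha y u b).
Proof.
move=> lu.
have lu' (U' : lmodType k) (f : U' -> A) : linear f -> linear (fun x => u (f x)).
  exact: lin_app.
transitivity (\sw_(x, y <- cop h) \sw_(p, q <- cop x)
    (act p a * act q (u (act (S y) b)))).
  by apply: tlift_eq => x y; rewrite /endo_la act_mul.
rewrite (coassocE (F := fun p q y => act p a * act q (u (act (S y) b))));
  [|by move=> *; repeat first [lin_step | apply: lu']..].
apply: tlift_eq => x y; rewrite /endo_ha.
by rewrite (tlift_app _ _ (f := fun z => act x a * z)) //; lin.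
Qed.

Lemma bder_closed : submod_closed (fun u => `[< braided_der u >]).
Proof.
apply: mk_closed => [|c u v [lu Lu] [lv Lv]]; split.
- by move=> c a b /=; rewrite scaler0 addr0.
- move=> a b /=; rewrite mul0r add0r.
  rewrite [RHS]big1 // => p _; rewrite /endo_ha [X in _ * X]big1 ?mulr0 // => q _.
  by rewrite /= (lin0 (@act_lin _ _ _ _)).
- by move=> d a b; rewrite !fctD !fctZ lu lv !scalerDr addrACA !scalerA mulrC.
- move=> a b; rewrite !fctD !fctZ Lu Lv scalerDr mulrDl -scalerAl -!addrA; congr (_ + _).
  rewrite addrCA; congr (_ + _).
  rewrite /tlift scaler_sumr -big_split; apply: eq_bigr => p _ /=.
  rewrite scalerAr -mulrDr; congr (_ * _).
  by rewrite (lin_endom _ _ (@lin_id k (A -> A))).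
Qed.
End BraidedDer.

Section VectorFields.
Variables (k : comUnitRingType) (H : triHopf k) (A : bcModAlg H).
Notation S := (@anti k H).
Notation Rb := (Rinv H).

Definition vf_sub : submodule (A -> A) := Submodule (@bder_closed k H A).
Definition vf : lmodType k := sm_type vf_sub.
Definition vapp (u : vf) : A -> A := \val u.

Lemma vf_der (u : vf) : braided_der (vapp u).
Proof. by apply/asboolP; exact: (valP u). Qed.
Lemma vapp_lin (u : vf) : linear (vapp u). Proof. by case: (vf_der u). Qed.
Lemma vappM (u : vf) a b :
  vapp u (a * b) = vapp u a * b + \sw_(x, y <- Rb) (act x a * endo_ha y (vapp u) b).
Proof. by case: (vf_der u). Qed.
Lemma vappP c (u v : vf) a : vapp (c *: u + v) a = c *: vapp u a + vapp v a.
Proof. by []. Qed.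
Lemma vapp_linl a : linear (vapp^~ a). Proof. by []. Qed.
Lemma vf_ext (u v : vf) : vapp u =1 vapp v -> u = v.
Proof. by move=> E; apply: val_inj; apply/funext. Qed.
Definition mk_vf u (du : braided_der u) : vf := sm_mk (D := vf_sub) (asboolT du).

Let lvapp (U : lmodType k) (g : U -> A) (u : vf) : linear g -> linear (fun x => vapp u (g x)).
Proof. by apply: lin_app; apply: vapp_lin. Qed.
Let lendol (U : lmodType k) (g : U -> H) (u : vf) a : linear g ->
  linear (fun x => endo_ha (g x) (vapp u) a).
Proof. by apply: lin_endol; apply: vapp_lin. Qed.
Let lendor (U : lmodType k) (g : U -> A) (u : vf) h : linear g ->
  linear (fun x => endo_ha h (vapp u) (g x)).
Proof. by apply: lin_endor; apply: vapp_lin. Qed.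
Ltac vlin := repeat first [lin_step | apply: lvapp | apply: lendol | apply: lendor].

Lemma vf_la_der a (u : vf) : braided_der (endo_la a (vapp u)).
Proof.
split=> [|b c]; first by rewrite /endo_la; vlin.
rewrite {1}/endo_la vappM mulrDr mulrA; congr (_ + _).
transitivity (\sw_(x, y <- Rb) \sw_(p, q <- cop y)
   (act x b * (act p a * endo_ha q (vapp u) c))); last first.
  apply: tlift_eq => x y; rewrite endo_ha_la; last exact: vapp_lin.
  by rewrite (tlift_app _ _ (f := fun z => act x b * z)) //; lin.
rewrite (Rinv_copr (F := fun x p q => act x b * (act p a * endo_ha q (vapp u) c)));
  [|by move=> *; vlin..].
rewrite exch_tlift (tlift_app _ _ (f := fun z => a * z)); last by lin.
apply: tlift_eq => x y; rewrite mulrA [a * _]act_bc.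
rewrite (tlift_app _ _ (f := fun z => z * endo_ha y (vapp u) c)); last by lin.
by apply: tlift_eq => p q; rewrite actM mulrA.
Qed.
Definition vf_la a u : vf := mk_vf (vf_la_der a u).

Lemma vf_ha_der h (u : vf) : braided_der (endo_ha h (vapp u)).
Proof.
split=> [|a b]; first by vlin.
pose F1 e f c d := act e (vapp u (act (S d) a)) * act (f * S c) b.
pose F2 e f c d := \sw_(r, s <- Rb)
  (act (e * r * S d) a * act f (endo_ha s (vapp u) (act (S c) b))).
transitivity (\sw_(x, y <- cop h) \sw_(e, f <- cop x) \sw_(c, d <- cop y) F1 e f c d +
              \sw_(x, y <- cop h) \sw_(e, f <- cop x) \sw_(c, d <- cop y) F2 e f c d).
  rewrite -tlift_add2; apply: tlift_eq => x y; rewrite -tlift_add2.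
  rewrite act_mul (anti_cop (F := fun p q => act p a * act q b)); last by lin.
  rewrite (tlift_app _ _ (@vapp_lin u)) (tlift_app _ _ (@act_lin _ _ _ x)).
  under [RHS]tlift_eq => e f do rewrite -tlift_add2.
  rewrite exch_tlift; apply: tlift_eq => c d.
  rewrite vappM (linD (@act_lin _ _ _ x)) tlift_add2; congr (_ + _).
    by rewrite act_mul; apply: tlift_eq => e f; rewrite /F1 actM.
  rewrite (tlift_app _ _ (@act_lin _ _ _ x)) /F2 exch_tlift; apply: tlift_eq => r s.
  by rewrite act_mul; apply: tlift_eq => e f; rewrite !actM.
congr (_ + _).
  rewrite cop4; [|by move=> *; rewrite /F1; vlin..].
  rewrite /endo_ha (tlift_app _ _ (f := fun z => z * b)); last by lin.
  apply: tlift_eq => e z.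
  apply: (counitlE (F := fun d => act e (vapp u (act (S d) a)) * b)); first by vlin.
  move=> w d.
  apply: (antirE (F := fun z => act e (vapp u (act (S d) a)) * act z b)) => //.
    by vlin.
  by rewrite act1.
rewrite cop4; [|by move=> *; rewrite /F2; vlin..].
pose G r s e w d := act (r * w * S d) a * endo_ha (s * e) (vapp u) b.
transitivity (\sw_(e, z <- cop h) \sw_(w, d <- cop z) \sw_(r, s <- Rb)
   (act (e * r * S d) a * endo_ha (w * s) (vapp u) b)).
  do 2!(apply: tlift_eq => ? ?); rewrite exch_tlift; apply: tlift_eq => r s.
  rewrite endo_haM; last exact: vapp_lin.
  by rewrite [in RHS]/endo_ha (tlift_app _ _ (f := fun z => _ * z)) //; lin.
rewrite -(coassocE (F := fun e w d => \sw_(r, s <- Rb)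
   (act (e * r * S d) a * endo_ha (w * s) (vapp u) b))); [|by move=> *; vlin..].
transitivity (\sw_(p, d <- cop h) \sw_(e, w <- cop p) \sw_(r, s <- Rb) G r s e w d).
  apply: tlift_eq => p d; rewrite [RHS]exch_tlift.
  by rewrite (Rinv_cop (F := fun x y => act (x * S d) a * endo_ha y (vapp u) b)) //; vlin.
rewrite coassocE; [|by move=> *; rewrite /G; vlin..].
transitivity (\sw_(r, s <- Rb) \sw_(e, z <- cop h) \sw_(w, d <- cop z) G r s e w d).
  by rewrite [RHS]exch_tlift; apply: tlift_eq => ? ?; rewrite exch_tlift.
apply: tlift_eq => r s; rewrite -endo_haM; last exact: vapp_lin.
apply: (counitrE (F := fun e => act r a * endo_ha (s * e) (vapp u) b)); first by vlin.
move=> e z.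
apply: (antirE (F := fun z => act (r * z) a * endo_ha (s * e) (vapp u) b)).
- by vlin.
- by move=> w d; rewrite /G mulrA.
- by rewrite mulr1.
Qed.
Definition vf_ha h u : vf := mk_vf (vf_ha_der h u).

Definition vf_ra u a : vf := \sw_(x, y <- Rb) vf_la (act x a) (vf_ha y u).

Lemma vf_la_bilin : bilin vf_la.
Proof.
split=> [u c a b|a c u v]; apply: vf_ext => d; rewrite vappP.
  by apply: (_ : linear (fun a : A => a * vapp u d)); lin.
by apply: (_ : linear (fun v => a * vapp v d)); apply: lin_mulr; apply: vapp_linl.
Qed.
Lemma vf_ha_bilin : bilin vf_ha.
Proof.
split=> [u c a b|a c u v]; apply: vf_ext => d; rewrite vappP.
  by apply: (_ : linear (fun h => endo_ha h (vapp u) d)); vlin.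
exact: (lin_endom (g := vapp)).
Qed.
Lemma vf_laA a b u : vf_la (a * b) u = vf_la a (vf_la b u).
Proof. by apply: vf_ext => d; apply: esym (mulrA _ _ _). Qed.
Lemma vf_la1 u : vf_la 1 u = u.
Proof. by apply: vf_ext => d; apply: mul1r. Qed.
Lemma vf_haM g h u : vf_ha (g * h) u = vf_ha g (vf_ha h u).
Proof. by apply: val_inj; apply: endo_haM; apply: vapp_lin. Qed.
Lemma vf_ha1 u : vf_ha 1 u = u.
Proof. by apply: val_inj; apply: endo_ha1; apply: vapp_lin. Qed.
Lemma vf_ha_la h a u : vf_ha h (vf_la a u) = \sw_(x, y <- cop h) vf_la (act x a) (vf_ha y u).
Proof.
apply: vf_ext => b; rewrite (tlift_app _ _ (@vapp_linl b)).
by rewrite -[LHS]/(endo_ha h (endo_la a (vapp u)) b) endo_ha_la //; apply: vapp_lin.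
Qed.

Definition VF : sbimod A :=
  mk_sbimod (V := vf) (ra := vf_ra) vf_la_bilin vf_ha_bilin vf_laA vf_la1
    vf_haM vf_ha1 vf_ha_la (fun _ _ => erefl).

Lemma act_vapp h (u : VF) a :
  act h (vapp u a) = \sw_(x, y <- cop h) vapp (ha x u) (act y a).
Proof.
symmetry.
transitivity (\sw_(x, y <- cop h) \sw_(c, d <- cop x) act c (vapp u (act (S d * y) a))).
  by do 2!(apply: tlift_eq => ? ?); rewrite actM.
rewrite (coassocE (F := fun c d y => act c (vapp u (act (S d * y) a))));
  [|by move=> *; vlin..].
apply: (counitrE (F := fun c => act c (vapp u a))); first by vlin.
move=> c z; apply: (antilE (F := fun t => act c (vapp u (act t a)))) => //.
  by vlin.
by rewrite act1.
Qed.

Lemma endo_ha_comp h (u v : VF) a :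
  endo_ha h (fun b => vapp u (vapp v b)) a =
  \sw_(x, y <- cop h) vapp (ha x u) (vapp (ha y v) a).
Proof.
symmetry.
pose F p q c d := act p (vapp u (act (S q * c) (vapp v (act (S d) a)))).
transitivity (\sw_(x, y <- cop h) \sw_(p, q <- cop x) \sw_(c, d <- cop y) F p q c d).
  apply: tlift_eq => x y; apply: tlift_eq => p q.
  rewrite (tlift_app _ _ (@act_lin _ _ _ (S q))) (tlift_app _ _ (@vapp_lin u)).
  rewrite (tlift_app _ _ (@act_lin _ _ _ p)).
  by apply: tlift_eq => c d; rewrite /F actM.
rewrite cop4; [|by move=> *; rewrite /F; vlin..].
apply: tlift_eq => p z.
apply: (counitlE (F := fun d => act p (vapp u (vapp v (act (S d) a))))); first by vlin.
move=> w d.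
apply: (antilE (F := fun t => act p (vapp u (act t (vapp v (act (S d) a)))))) => //.
  by vlin.
by rewrite act1.
Qed.

(* u o v - (R^alpha |> v) o (R_alpha |> u) *)
Definition bracket_fun (u v : VF) : A -> A := fun a =>
  vapp u (vapp v a) - \sw_(x, y <- Rb) vapp (ha x v) (vapp (ha y u) a).

Let lvappl (U : lmodType k) (g : U -> VF) a : linear g -> linear (fun x => vapp (g x) a).
Proof. by move=> lg c x y; rewrite lg. Qed.
Ltac wlin := repeat first [lin_step | apply: lvapp | apply: lvappl].

Let comp_mul (u v : VF) a b :
  vapp u (vapp v (a * b)) = vapp u (vapp v a) * b
  + \sw_(r, s <- Rb) (act r (vapp v a) * vapp (ha s u) b)
  + \sw_(x, y <- Rb) (vapp u (act x a) * vapp (ha y v) b)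
  + \sw_(x, y <- Rb) (act x a * endo_ha y (fun b => vapp u (vapp v b)) b).
Proof.
rewrite vappM (linD (@vapp_lin u)) vappM -!addrA; congr (_ + (_ + _)).
rewrite (tlift_app _ _ (@vapp_lin u)).
transitivity (\sw_(x, y <- Rb) (vapp u (act x a) * vapp (ha y v) b
   + \sw_(r, s <- Rb) (act r (act x a) * vapp (ha s u) (vapp (ha y v) b)))).
  by apply: tlift_eq => x y; rewrite vappM.
rewrite tlift_add2; congr (_ + _).
transitivity (\sw_(x, y <- Rb) \sw_(p, q <- cop y)
   (act x a * vapp (ha p u) (vapp (ha q v) b))); last first.
  apply: tlift_eq => x y; rewrite endo_ha_comp.
  by rewrite (tlift_app _ _ (f := fun z => act x a * z)) //; lin.
rewrite (Rinv_copr (F := fun x p q => act x a * vapp (ha p u) (vapp (ha q v) b)));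
  [|by move=> *; wlin..].
rewrite exch_tlift; do 2!(apply: tlift_eq => ? ?).
by rewrite actM.
Qed.

Let addr_cancel (V : zmodType) (p q e f x y : V) :
  p + e + f + x - (q + f + e + y) = p - q + (x - y).
Proof.
rewrite -(addrA p e f) -(addrA q f e) [f + e]addrC.
move: (e + f) => g; rewrite (addrAC p) (addrAC q) opprD addrACA subrr addr0.
by rewrite opprD addrACA.
Qed.

Lemma bracket_der (u v : VF) : braided_der (bracket_fun u v).
Proof.
split=> [|a b]; first by rewrite /bracket_fun; wlin.
rewrite /bracket_fun comp_mul.
under [X in _ - X = _]tlift_eq => p q do rewrite comp_mul.
rewrite !tlift_add2.
have -> : \sw_(x, y <- Rb) (act x a * endo_ha y (bracket_fun u v) b) =
  \sw_(x, y <- Rb) (act x a * endo_ha y (fun b => vapp u (vapp v b)) b) -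
  \sw_(p, q <- Rb) \sw_(x, y <- Rb)
    (act x a * endo_ha y (fun b => vapp (ha p v) (vapp (ha q u) b)) b).
  rewrite [X in _ - X]exch_tlift -[RHS]/(_ - _) /tlift -sumrB; apply: eq_bigr => c _.
  rewrite -mulr_sumr -mulrBr; congr (_ * _).
  rewrite /endo_ha exchange_big -sumrB; apply: eq_bigr => p _ /=.
  rewrite /bracket_fun (linD (@act_lin _ _ _ _)) (linN (@act_lin _ _ _ _)); congr (_ - _).
  by rewrite /tlift (lin_sum (@act_lin _ _ _ _)).
have E1 : \sw_(p, q <- Rb) \sw_(x, y <- Rb)
     (vapp (ha p v) (act x a) * vapp (ha y (ha q u)) b) =
   \sw_(r, s <- Rb) (act r (vapp v a) * vapp (ha s u) b).
  symmetry; transitivity (\sw_(r, s <- Rb) \sw_(c, d <- cop r)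
     (vapp (ha c v) (act d a) * vapp (ha s u) b)).
    apply: tlift_eq => r s; rewrite act_vapp.
    by rewrite (tlift_app _ _ (f := fun z => z * vapp (ha s u) b)) //; lin.
  rewrite (Rinv_copl (F := fun c d s => vapp (ha c v) (act d a) * vapp (ha s u) b));
    [|by move=> *; wlin..].
  by rewrite exch_tlift; do 2!(apply: tlift_eq => ? ?); rewrite haM.
have E2 : \sw_(p, q <- Rb) \sw_(r, s <- Rb)
     (act r (vapp (ha q u) a) * vapp (ha s (ha p v)) b) =
   \sw_(x, y <- Rb) (vapp u (act x a) * vapp (ha y v) b).
  transitivity (\sw_(p, q <- Rb) \sw_(c, d <- Rb) \sw_(x, y <- Rb)
     (vapp (ha (x * q) u) (act c a) * vapp (ha (d * (y * p)) v) b)).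
    apply: tlift_eq => p q.
    transitivity (\sw_(r, s <- Rb) \sw_(c, d <- cop r)
     (vapp (ha (c * q) u) (act d a) * vapp (ha (s * p) v) b)).
      apply: tlift_eq => r s; rewrite act_vapp.
      rewrite (tlift_app _ _ (f := fun z => z * vapp (ha s (ha p v)) b)); last by lin.
      by apply: tlift_eq => c d; rewrite !haM.
    rewrite (Rinv_copl (F := fun c d s =>
      vapp (ha (c * q) u) (act d a) * vapp (ha (s * p) v) b)); [|by move=> *; wlin..].
    by do 2!(apply: tlift_eq => ? ?); rewrite !haM.
  rewrite exch_tlift; apply: tlift_eq => c d; rewrite exch_tlift.
  rewrite (Rinv_flip (F := fun x y =>
    vapp (ha x u) (act c a) * vapp (ha (d * y) v) b)); last by wlin.
  by rewrite ha1 mulr1.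
rewrite E1 E2 mulrBl.
have -> : (\sw_(x, y <- Rb) vapp (ha x v) (vapp (ha y u) a)) * b =
  \sw_(x, y <- Rb) (vapp (ha x v) (vapp (ha y u) a) * b).
  by rewrite (tlift_app _ _ (f := fun z => z * b)) //; lin.
exact: addr_cancel.
Qed.
Definition bracket (u v : VF) : VF := mk_vf (bracket_der u v).
End VectorFields.

Section Morphisms.
Variables (k : comUnitRingType) (H : triHopf k) (A : bcModAlg H).
Notation Rb := (Rinv H).
Implicit Types V W Z : sbimod A.

Definition bim_mor V W (f : V -> W) : Prop :=
  [/\ linear f, forall a v, f (la a v) = la a (f v)
    & forall h v, f (ha h v) = ha h (f v)].

Lemma mor_ra V W (f : V -> W) : bim_mor f -> forall v a, f (ra v a) = ra (f v) a.
Proof.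
case=> lf laf haf v a; rewrite !raE (tlift_app _ _ lf).
by apply: tlift_eq => x y; rewrite laf haf.
Qed.
Lemma mor_id V : bim_mor (fun v : V => v). Proof. by []. Qed.
Lemma mor_comp V W Z (f : W -> Z) (g : V -> W) : bim_mor f -> bim_mor g ->
  bim_mor (fun v => f (g v)).
Proof.
case=> lf laf haf [lg lag hag]; split; first exact: lin_app.
- by move=> a v; rewrite lag laf.
- by move=> h v; rewrite hag haf.
Qed.
Lemma mor_scale V W c (f : V -> W) : bim_mor f -> bim_mor (fun v => c *: f v).
Proof.
case=> lf laf haf; split; first exact: lin_scale.
- by move=> a v; rewrite laf (linZ (@la_lin _ _ _ _ a)).
- by move=> h v; rewrite haf (linZ (@ha_lin _ _ _ _ h)).
Qed.
Lemma mor_sub V W (f g : V -> W) : bim_mor f -> bim_mor g -> bim_mor (fun v => f v - g v).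
Proof.
case=> lf laf haf [lg lag hag]; split.
- by apply: lin_add => //; apply: lin_opp.
- by move=> a v; rewrite laf lag (linD (@la_lin _ _ _ _ a)) (linN (@la_lin _ _ _ _ a)).
- by move=> a v; rewrite haf hag (linD (@ha_lin _ _ _ _ a)) (linN (@ha_lin _ _ _ _ a)).
Qed.
Lemma mor_sum V W (I : Type) (s : seq I) (F : I -> V -> W) : (forall i, bim_mor (F i)) ->
  bim_mor (fun v => \sum_(i <- s) F i v).
Proof.
move=> mF; split.
- by apply: lin_bigsum => i; case: (mF i).
- move=> a v; rewrite (lin_sum (@la_lin _ _ _ _ a)); apply: eq_bigr => i _.
  by case: (mF i).
- move=> a v; rewrite (lin_sum (@ha_lin _ _ _ _ a)); apply: eq_bigr => i _.
  by case: (mF i).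
Qed.

Notation tbal V W f := (balanced (@ra _ _ _ V) (@la _ _ _ W) f).

Lemma ten_la V W a (v : V) (w : W) : la a (ten v w) = ten (la a v) w.
Proof. exact: tens_laE. Qed.
Lemma ten_ra V W a (v : V) (w : W) : ra (ten v w) a = ten v (ra w a).
Proof. exact: tens_raE. Qed.
Lemma ten_ha V W h (v : V) (w : W) :
  ha h (ten v w) = \sw_(x, y <- cop h) ten (ha x v) (ha y w).
Proof. exact: tens_haE. Qed.
Lemma ten_bal V W a (v : V) (w : W) : ten (ra v a) w = ten v (la a w).
Proof. exact: tpair_bal. Qed.
Lemma lin_tenl V W (U : lmodType k) (g : U -> V) (w : W) : linear g ->
  linear (fun x => ten (g x) w).
Proof. exact: lin_tpairl. Qed.
Lemma lin_tenr V W (U : lmodType k) (g : U -> W) (v : V) : linear g ->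
  linear (fun x => ten v (g x)).
Proof. exact: lin_tpairr. Qed.
Lemma tlift_ten V W (M : lmodType k) (f : V -> W -> M) v w : tbal V W f ->
  tlift f (ten v w) = f v w.
Proof. exact: tlift_tpair. Qed.
Lemma tensor_ext V W (M : lmodType k) (f g : tensor V W -> M) :
  linear f -> linear g -> (forall v w, f (ten v w) = g (ten v w)) -> f =1 g.
Proof. exact: tens_lin_ext. Qed.
Ltac tlin := repeat first [apply: lin_tenl | apply: lin_tenr | lin_step].

Lemma mor_tlift V W Z (f : V -> W -> Z) : tbal V W f ->
  (forall a v w, f (la a v) w = la a (f v w)) ->
  (forall h v w, \sw_(x, y <- cop h) f (ha x v) (ha y w) = ha h (f v w)) ->
  bim_mor (fun t : tensor V W => tlift f t).
Proof.
move=> bf laf haf; have lf := tlift_linear bf; split=> //.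
- move=> a; apply: (tensor_ext (f := fun t => tlift f (la a t : tensor V W))
    (g := fun t => la a (tlift f t))).
  + by apply: lin_app => //; apply: la_lin.
  + by apply: lin_app => //; apply: la_lin.
  + by move=> v w; rewrite ten_la !tlift_ten.
- move=> h; apply: (tensor_ext (f := fun t => tlift f (ha h t : tensor V W))
    (g := fun t => ha h (tlift f t))).
  + by apply: lin_app => //; apply: ha_lin.
  + by apply: lin_app => //; apply: ha_lin.
  + move=> v w; rewrite ten_ha (tlift_app _ _ lf) tlift_ten // -haf.
    by apply: tlift_eq => x y; rewrite tlift_ten.
Qed.

Definition tmap V W V' W' (f : V -> V') (g : W -> W') (t : tensor V W) : tensor V' W' :=
  \sw_(v, w <- t) ten (f v) (g w).
Lemma tmap_bal V W V' W' (f : V -> V') (g : W -> W') : bim_mor f -> bim_mor g ->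
  tbal V W (fun v w => ten (f v) (g w)).
Proof.
move=> mf mg; have [lf _ _] := mf; have [lg lag _] := mg; split.
- by move=> w; apply: lin_tenl.
- by move=> v; apply: lin_tenr.
- by move=> v b w; rewrite (mor_ra mf) lag ten_bal.
Qed.
Lemma mor_tmap V W V' W' (f : V -> V') (g : W -> W') : bim_mor f -> bim_mor g ->
  bim_mor (tmap f g).
Proof.
move=> mf mg; have [lf laf haf] := mf; have [lg lag hag] := mg.
apply: mor_tlift; first exact: tmap_bal.
- by move=> a v w; rewrite laf ten_la.
- by move=> h v w; rewrite ten_ha; apply: tlift_eq => x y; rewrite haf hag.
Qed.

Definition tau V W (t : tensor V W) : tensor W V :=
  \sw_(v, w <- t) \sw_(x, y <- Rb) ten (ha x w) (ha y v).
Lemma tau_bal V W :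
  tbal V W (fun v w => \sw_(x, y <- Rb) (ten (ha x w) (ha y v) : tensor W V)).
Proof.
split=> [w|v|v a w]; [by tlin|by tlin|].
transitivity (\sw_(r, s <- Rb) \sw_(p, q <- Rb) \sw_(c, d <- cop q)
    (ten (ha p w) (la (act (c * r) a) (ha (d * s) v)) : tensor W V)).
  rewrite [RHS]exch_tlift; apply: tlift_eq => p q.
  have lf : linear (fun z => ten (ha p w) (ha q z) : tensor W V) by tlin.
  rewrite raE (tlift_app _ _ lf); apply: tlift_eq => r s.
  have lf' : linear (fun z => ten (ha p w) z : tensor W V) by tlin.
  rewrite ha_la (tlift_app _ _ lf'); apply: tlift_eq => c d.
  by rewrite actM haM.
have lf x : linear (fun z => ten z (ha x v) : tensor W V) by tlin.
transitivity (\sw_(x, y <- Rb) \sw_(c, d <- cop x)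
    (ten (la (act c a) (ha d w)) (ha y v) : tensor W V)); last first.
  by apply: tlift_eq => x y; rewrite ha_la (tlift_app _ _ (lf _)).
rewrite (Rinv_copl (F := fun c d y => ten (la (act c a) (ha d w)) (ha y v) : tensor W V));
  [|by move=> *; tlin..].
rewrite [RHS]exch_tlift; apply: tlift_eq => r s.
rewrite (Rinv_copr (F := fun p c d =>
  ten (ha p w) (la (act (c * r) a) (ha (d * s) v)) : tensor W V)); [|by move=> *; tlin..].
rewrite exch_tlift; apply: tlift_eq => p' q'.
transitivity (\sw_(p, q <- Rb) \sw_(t, u <- Rb)
  (ten (la (act (t * q * r) a) (ha (u * p * p') w)) (ha (q' * s) v) : tensor W V)).
  apply: tlift_eq => p q; rewrite -ten_bal raE (tlift_app _ _ (lf _)).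
  by apply: tlift_eq => t u; rewrite -!actM -!haM !mulrA.
rewrite exch_tlift (Rinv_flip (F := fun x y =>
  ten (la (act (x * r) a) (ha (y * p') w)) (ha (q' * s) v) : tensor W V)); last by tlin.
by rewrite !mul1r.
Qed.
Lemma tau_ten V W (v : V) (w : W) :
  tau (ten v w) = \sw_(x, y <- Rb) ten (ha x w) (ha y v).
Proof. by rewrite /tau tlift_ten //; apply: tau_bal. Qed.
Lemma mor_tau V W : bim_mor (@tau V W).
Proof.
apply: mor_tlift; first exact: tau_bal.
- move=> a v w.
  transitivity (\sw_(x, y <- Rb) \sw_(c, d <- cop y)
    (ten (ha x w) (la (act c a) (ha d v)) : tensor W V)).
    apply: tlift_eq => x y; rewrite ha_la.
    by rewrite (tlift_app _ _ (f := fun z => ten (ha x w) z : tensor W V)) //; tlin.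
  rewrite (Rinv_copr (F := fun x c d =>
    ten (ha x w) (la (act c a) (ha d v)) : tensor W V)); [|by move=> *; tlin..].
  rewrite exch_tlift (tlift_app _ _ (@la_lin _ _ _ _ a)); apply: tlift_eq => x y.
  rewrite ten_la la_sym.
  rewrite (tlift_app _ _ (f := fun z => ten z (ha y v) : tensor W V)); last by tlin.
  by apply: tlift_eq => c d; rewrite ten_bal haM.
- move=> h v w; rewrite (tlift_app _ _ (@ha_lin _ _ _ _ h)).
  transitivity (\sw_(p, q <- Rb) \sw_(x, y <- cop h)
    (ten (ha (p * y) w) (ha (q * x) v) : tensor W V)).
    by rewrite exch_tlift; do 2!(apply: tlift_eq => ? ?); rewrite !haM.
  rewrite -(Rinv_cop (F := fun x y => ten (ha x w) (ha y v) : tensor W V)); last by tlin.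
  rewrite exch_tlift; apply: tlift_eq => x y; rewrite ten_ha.
  by apply: tlift_eq => c d; rewrite !haM.
Qed.

Section Assoc.
Variables V W Z : sbimod A.
Definition tassocl (t : tensor V (tensor W Z)) : tensor (tensor V W) Z :=
  \sw_(v, s <- t) \sw_(w, z <- s) ten (ten v w) z.
Definition tassocr (t : tensor (tensor V W) Z) : tensor V (tensor W Z) :=
  \sw_(s, z <- t) \sw_(v, w <- s) ten v (ten w z).

Let balr v : tbal W Z (fun w z => (ten (ten v w) z : tensor (tensor V W) Z)).
Proof.
split=> [z|w|w b z]; [by tlin|by tlin|].
by rewrite -ten_ra ten_bal.
Qed.
Let ball z : tbal V W (fun v w => (ten v (ten w z) : tensor V (tensor W Z))).
Proof.
split=> [w|v|v b w]; [by tlin|by tlin|].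
by rewrite ten_bal ten_la.
Qed.
Let liftr (v : V) (s : tensor W Z) : tensor (tensor V W) Z := \sw_(w, z <- s) ten (ten v w) z.
Let liftl (s : tensor V W) (z : Z) : tensor V (tensor W Z) := \sw_(v, w <- s) ten v (ten w z).
Let liftr_lin v : linear (liftr v). Proof. exact: tlift_linear. Qed.
Let liftl_lin z : linear (liftl^~ z). Proof. exact: (tlift_linear (ball z)). Qed.
Let liftrE v w z : liftr v (ten w z) = ten (ten v w) z. Proof. exact: tlift_ten. Qed.
Let liftlE v w z : liftl (ten v w) z = ten v (ten w z).
Proof. exact: (tlift_ten _ _ (ball z)). Qed.

Lemma mor_assocl : bim_mor tassocl.
Proof.
apply: (mor_tlift (f := liftr)).
- split; [by move=> s; rewrite /liftr; tlin|by []|].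
  move=> v b; apply: (tensor_ext (f := liftr (ra v b)) (g := fun s => liftr v (la b s))) => //.
    by apply: lin_app; [apply: liftr_lin|apply: la_lin].
  by move=> w z; rewrite ten_la !liftrE ten_bal.
- move=> a v; apply: (tensor_ext (f := liftr (la a v)) (g := fun s => la a (liftr v s))) => //.
    by apply: lin_app; [apply: la_lin|apply: liftr_lin].
  by move=> w z; rewrite !liftrE !ten_la.
- move=> h v; apply: (tensor_ext (f := fun s => \sw_(x, y <- cop h) liftr (ha x v) (ha y s))
    (g := fun s => ha h (liftr v s))).
  + by apply: lin_tliftc => x y; apply: lin_app; [apply: liftr_lin|apply: ha_lin].
  + by apply: lin_app; [apply: ha_lin|apply: liftr_lin].
  move=> w z; rewrite liftrE ten_ha.
  transitivity (\sw_(x, y <- cop h) \sw_(c, d <- cop y)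
    (ten (ten (ha x v) (ha c w)) (ha d z) : tensor (tensor V W) Z)).
    apply: tlift_eq => x y; rewrite ten_ha (tlift_app _ _ (liftr_lin _)).
    by apply: tlift_eq => c d; rewrite liftrE.
  rewrite -(coassocE (F := fun x c d =>
    (ten (ten (ha x v) (ha c w)) (ha d z) : tensor (tensor V W) Z)));
    [|by move=> *; tlin..].
  apply: tlift_eq => x y; rewrite ten_ha.
  by rewrite (tlift_app _ _ (f := fun s => ten s (ha y z) : tensor (tensor V W) Z)) //; tlin.
Qed.

Lemma mor_assocr : bim_mor tassocr.
Proof.
apply: (mor_tlift (f := liftl)).
- split; [by []|by move=> s; rewrite /liftl; tlin|].
  move=> s b z; move: s.
  apply: (tensor_ext (f := fun s => liftl (ra s b) z) (g := liftl^~ (la b z))) => //.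
    by apply: (lin_app (f := liftl^~ z)) => //; apply: ra_lin.
  by move=> v w; rewrite ten_ra !liftlE ten_bal.
- move=> a s z; move: s.
  apply: (tensor_ext (f := fun s => liftl (la a s) z) (g := fun s => la a (liftl s z))).
  + by apply: (lin_app (f := liftl^~ z)) => //; apply: la_lin.
  + by apply: lin_app => //; apply: la_lin.
  by move=> v w; rewrite ten_la !liftlE ten_la.
- move=> h s z; move: s.
  apply: (tensor_ext (f := fun s => \sw_(x, y <- cop h) liftl (ha x s) (ha y z))
    (g := fun s => ha h (liftl s z))).
  + apply: lin_tliftc => x y; apply: (lin_app (f := liftl^~ (ha y z))) => //.
    exact: ha_lin.
  + by apply: lin_app => //; apply: ha_lin.
  move=> v w; rewrite liftlE ten_ha.
  transitivity (\sw_(x, y <- cop h) \sw_(c, d <- cop x)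
    (ten (ha c v) (ten (ha d w) (ha y z)) : tensor V (tensor W Z))).
    apply: tlift_eq => x y; rewrite ten_ha (tlift_app _ _ (liftl_lin _)).
    by apply: tlift_eq => c d; rewrite liftlE.
  rewrite (coassocE (F := fun c d y =>
    (ten (ha c v) (ten (ha d w) (ha y z)) : tensor V (tensor W Z))));
    [|by move=> *; tlin..].
  apply: tlift_eq => x y; rewrite ten_ha.
  by rewrite (tlift_app _ _ (f := fun s => ten (ha x v) s : tensor V (tensor W Z))) //; tlin.
Qed.
End Assoc.

Definition tau12 V W Z (t : tensor V (tensor W Z)) : tensor W (tensor V Z) :=
  tassocr (tmap (@tau V W) (fun z : Z => z) (tassocl t)).
Lemma mor_tau12 V W Z : bim_mor (@tau12 V W Z).
Proof.
apply: (mor_comp (f := @tassocr W V Z)); first exact: mor_assocr.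
apply: (mor_comp (f := tmap (@tau V W) (fun z : Z => z))); last exact: mor_assocl.
by apply: mor_tmap; [apply: mor_tau | apply: mor_id].
Qed.
End Morphisms.

Section SubBimodule.
Variables (k : comUnitRingType) (H : triHopf k) (A : bcModAlg H) (V : sbimod A).

Lemma sm_tlift (E : lmodType k) (D : submodule E) (B : Type) (X Y : lmodType k)
  (r : X -> B -> X) (l : B -> Y -> Y) (F : X -> Y -> E) (t : tens r l) :
  (forall x y, sm_mem D (F x y)) -> sm_mem D (tlift F t).
Proof.
have [D0 DD] := sm_closed D.
move=> DF; rewrite /tlift; elim/big_ind: _ => //.
by move=> x y Dx Dy; rewrite -[x]scale1r; apply: DD.
Qed.

Variable D : submodule V.
Hypothesis Dla : forall a v, sm_mem D v -> sm_mem D (la a v).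
Hypothesis Dha : forall h v, sm_mem D v -> sm_mem D (ha h v).
Let Dra v a : sm_mem D v -> sm_mem D (ra v a).
Proof. by move=> Dv; rewrite raE; apply: sm_tlift => x y; apply/Dla/Dha. Qed.

Definition sub_la a (v : sm_type D) : sm_type D := sm_mk (Dla a (valP v)).
Definition sub_ra (v : sm_type D) a : sm_type D := sm_mk (Dra a (valP v)).
Definition sub_ha h (v : sm_type D) : sm_type D := sm_mk (Dha h (valP v)).

Let val_tlift (B : Type) (X Y : lmodType k)
  (r : X -> B -> X) (l : B -> Y -> Y) (F : X -> Y -> sm_type D) (t : tens r l) :
  \val (tlift F t) = tlift (fun x y => \val (F x y)) t.
Proof. exact: (tlift_app _ _ (@sm_lin _ _ D)). Qed.

Lemma sub_la_bilin : bilin sub_la.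
Proof.
split=> [v c a b|a c u v]; apply: val_inj.
  by apply: (_ : linear (fun a => la a (val v))); lin.
exact: (@la_lin _ _ _ V a).
Qed.
Lemma sub_ha_bilin : bilin sub_ha.
Proof.
split=> [v c a b|a c u v]; apply: val_inj.
  by apply: (_ : linear (fun a => ha a (val v))); lin.
exact: (@ha_lin _ _ _ V a).
Qed.
Lemma sub_laA a b v : sub_la (a * b) v = sub_la a (sub_la b v).
Proof. by apply: val_inj; apply: laA. Qed.
Lemma sub_la1 v : sub_la 1 v = v. Proof. by apply: val_inj; apply: la1. Qed.
Lemma sub_haM g h v : sub_ha (g * h) v = sub_ha g (sub_ha h v).
Proof. by apply: val_inj; apply: haM. Qed.
Lemma sub_ha1 v : sub_ha 1 v = v. Proof. by apply: val_inj; apply: ha1. Qed.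
Lemma sub_ha_la h a v :
  sub_ha h (sub_la a v) = \sw_(x, y <- cop h) sub_la (act x a) (sub_ha y v).
Proof. by apply: val_inj; rewrite val_tlift; apply: ha_la. Qed.
Lemma sub_raE v a : sub_ra v a = \sw_(x, y <- Rinv H) sub_la (act x a) (sub_ha y v).
Proof. by apply: val_inj; rewrite val_tlift; apply: raE. Qed.

Definition sub_bimod : sbimod A :=
  mk_sbimod (V := sm_type D) (ra := sub_ra) sub_la_bilin sub_ha_bilin sub_laA sub_la1
    sub_haM sub_ha1 sub_ha_la sub_raE.
End SubBimodule.

Section Image.
Variables (k : comUnitRingType) (H : triHopf k) (A : bcModAlg H) (V W : sbimod A).
Variables (f : V -> W) (mf : bim_mor f).
Lemma im_closed : submod_closed (fun w => `[< exists v, w = f v >]).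
Proof.
have [lf _ _] := mf; apply: mk_closed; first by exists 0; rewrite (lin0 lf).
by move=> c _ _ [u ->] [v ->]; exists (c *: u + v); rewrite lf.
Qed.
Definition im_sub : submodule W := Submodule im_closed.
Lemma im_la a w : sm_mem im_sub w -> sm_mem im_sub (la a w).
Proof.
by case: mf => _ laf _ /asboolP[v ->]; apply/asboolP; exists (la a v); rewrite laf.
Qed.
Lemma im_ha h w : sm_mem im_sub w -> sm_mem im_sub (ha h w).
Proof.
by case: mf => _ _ haf /asboolP[v ->]; apply/asboolP; exists (ha h v); rewrite haf.
Qed.
Definition im_bimod : sbimod A := sub_bimod im_la im_ha.
Definition im_val (w : im_bimod) : W := \val w.
Lemma im_mk_subproof v : sm_mem im_sub (f v).
Proof. by apply/asboolP; exists v. Qed.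
Definition im_mk v : im_bimod := sm_mk (im_mk_subproof v).
End Image.

Section AdjacentTranspositions.
Variable r : nat.

Definition adj (i : 'I_r) : 'S_r.+1 := tperm (widen_ord (leqnSn r) i) (lift ord0 i).

Let gen (s : 'S_r.+1) : bool := `[< exists w : seq 'I_r, (\prod_(i <- w) adj i)%g = s >].
Let gen1 : gen 1%g. Proof. by apply/asboolP; exists [::]; rewrite big_nil. Qed.
Let genM s t : gen s -> gen t -> gen (s * t)%g.
Proof.
move=> /asboolP[v <-] /asboolP[w <-]; apply/asboolP; exists (v ++ w).
by rewrite big_cat.
Qed.
Let gen_adj i : gen (adj i).
Proof. by apply/asboolP; exists [:: i]; rewrite big_seq1. Qed.

Let gen_tperm_lt d (x y : 'I_r.+1) : y = (x + d.+1)%N :> nat -> gen (tperm x y).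
Proof.
elim: d y => [|d IHd] y Ey.
  have xr : (x < r)%N by have := ltn_ord y; rewrite Ey addn1 ltnS.
  have -> : tperm x y = adj (Ordinal xr); last exact: gen_adj.
  by rewrite /adj; congr tperm; apply: ord_inj; rewrite ?lift0 ?Ey ?addn1.
have zr : (x + d.+1 < r)%N by have := ltn_ord y; rewrite Ey addnS ltnS.
pose z := widen_ord (leqnSn r) (Ordinal zr).
have Eyz : y = lift ord0 (Ordinal zr) by apply: ord_inj; rewrite lift0 Ey addnS.
have -> : tperm x y = (tperm x z ^ adj (Ordinal zr))%g.
  rewrite tpermJ /adj -Eyz tpermL; congr tperm; rewrite tpermD //.
    by apply/eqP => /(congr1 val) /= /eqP; rewrite -[X in _ == X]addn0 eqn_add2l.
  by apply/eqP => /(congr1 val) /= /eqP; rewrite Ey -[X in _ == X]addn0 eqn_add2l.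
rewrite /conjg tpermV.
by apply: (genM (gen_adj _)); apply: (genM _ (gen_adj _)); apply: IHd.
Qed.

Lemma adj_gen (s : 'S_r.+1) : exists w : seq 'I_r, (\prod_(i <- w) adj i)%g == s.
Proof.
suff /asboolP[w <-] : gen s by exists w.
have [ts -> _] := prod_tpermP s; elim/big_ind: _ => // -[x y] _ /=.
have [E|nE] := eqVneq (x : nat) y.
  by rewrite (val_inj E) tperm1.
wlog lt_xy : x y nE / (x < y)%N.
  move=> W; move: (nE); rewrite neq_ltn => /orP[|] lt; first exact: W.
  by rewrite tpermC; apply: W; rewrite // eq_sym.
by apply: (gen_tperm_lt (d := (y - x.+1)%N)); rewrite addnS -addSn subnKC.
Qed.

(* A word in the adjacent transpositions with product s. *)
Definition adj_word (s : 'S_r.+1) : seq 'I_r := xchoose (adj_gen s).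
End AdjacentTranspositions.

Section TensorPowers.
Variables (k : comUnitRingType) (H : triHopf k) (A : bcModAlg H) (V : sbimod A).

(* The n-th tensor power of V over A, with Tpow 1 = V on the nose. *)
Fixpoint Tpow (n : nat) : sbimod A :=
  if n is m.+1 then (if m is 0 then V else tensor V (Tpow m)) else regular A.

Definition tcons (n : nat) : V -> Tpow n -> Tpow n.+1 :=
  match n return V -> Tpow n -> Tpow n.+1 with
  | 0 => fun v a => ra v a
  | n'.+1 => fun v t => ten v t
  end.

Fixpoint tcat (m n : nat) : Tpow m -> Tpow n -> Tpow (m + n) :=
  match m return Tpow m -> Tpow n -> Tpow (m + n) with
  | 0 => fun a t => la a t
  | m'.+1 =>
    match m' return (Tpow m' -> Tpow n -> Tpow (m' + n)) ->
                    Tpow m'.+1 -> Tpow n -> Tpow (m'.+1 + n) with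
    | 0 => fun _ v t => tcons v t
    | m''.+1 => fun cat s t => \sw_(v, s' <- (s : tensor V (Tpow m''.+1))) tcons v (cat s' t)
    end (@tcat m' n)
  end.

Fixpoint tau_at (i n : nat) {struct n} : Tpow n -> Tpow n :=
  match n return Tpow n -> Tpow n with
  | 0 => fun t => t
  | m.+1 =>
    match m return (Tpow m -> Tpow m) -> Tpow m.+1 -> Tpow m.+1 with
    | 0 => fun _ t => t
    | m'.+1 => fun rec =>
      if i is 0 then
        match m' return Tpow m'.+2 -> Tpow m'.+2 with
        | 0 => @tau _ _ _ V V
        | m''.+1 => @tau12 _ _ _ V V (Tpow m''.+1)
        end
      else tmap (V := V) (W := Tpow m'.+1) (V' := V) (W' := Tpow m'.+1) (fun v => v) rec
    end (@tau_at i.-1 m)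
  end.

Lemma mor_tau_at i n : bim_mor (@tau_at i n).
Proof.
elim: n i => [|[|m] IHm] i; [exact: mor_id|exact: mor_id|].
case: i => [|i]; last by apply: mor_tmap; [exact: mor_id|exact: IHm].
by case: m IHm => [|m] _; [exact: mor_tau|exact: mor_tau12].
Qed.

(* The operator on tensor powers attached to a permutation. As tau is an
   involutive symmetry it depends on s only, not on the word chosen for it; the
   words are read backwards, which is harmless in the sum over all of 'S_r. *)
Definition Perm (r : nat) (s : 'S_r.+1) (t : Tpow r.+1) : Tpow r.+1 :=
  foldr (fun i : 'I_r => @tau_at i r.+1) t (adj_word s).
Lemma mor_Perm r s : bim_mor (@Perm r s).
Proof.
rewrite /Perm; elim: (adj_word s) => [|i w IHw]; first exact: mor_id.
exact: (mor_comp (mor_tau_at i r.+1) IHw).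
Qed.

(* A_r *)
Definition antisym (r : nat) : Tpow r -> Tpow r :=
  match r return Tpow r -> Tpow r with
  | 0 => fun t => t
  | r'.+1 => fun t => (r'.+1`!%:R)^-1 *: \sum_(s : 'S_r'.+1) ((-1) ^+ s *: Perm s t)
  end.
Lemma mor_antisym r : bim_mor (@antisym r).
Proof.
case: r => [|r]; first exact: mor_id.
apply: mor_scale; apply: mor_sum => s; apply: mor_scale; exact: mor_Perm.
Qed.

Lemma antisym1 (v : V) : antisym (r := 1) v = v.
Proof.
have PermI (s : 'S_1) : Perm s (v : Tpow 1) = v.
  by rewrite /Perm; case: (adj_word s) => // -[].
rewrite /antisym invr1 scale1r (big_pred1 1%g) => [|s].
  by rewrite odd_perm1 scale1r PermI.
by symmetry; apply/eqP/permP => i; rewrite !ord1.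
Qed.

(* The image of A_r, and alt : t |-> A_r t with values in it. For t of degree 0
   or 1, alt t is t itself. *)
Definition Alt (r : nat) : sbimod A := im_bimod (mor_antisym r).
Definition alt_val r (t : Alt r) : Tpow r := im_val t.
Definition alt r (t : Tpow r) : Alt r := im_mk (mor_antisym r) t.

Definition wedge r s (x : Alt r) (y : Alt s) : Alt (r + s) :=
  ((r + s)`!%:R / (r`!%:R * s`!%:R)) *: alt (tcat (alt_val x) (alt_val y)).

Definition cast_alt m n (e : m = n) (x : Alt m) : Alt n := ecast i (Alt i) e x.
End TensorPowers.
Section Forms.
Variables (k : comUnitRingType) (H : triHopf k) (A : bcModAlg H).
Notation X := (VF A).
Notation T := (@antiV k H).
Definition dualX : sbimod A := hom_bimod X (regular A).

Lemma ev_ll (a : A) : left_linear (V := X) (W := regular A) (fun u : X => vapp u a).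
Proof. by split=> [|b u]; [exact: vapp_linl | by []]. Qed.
Definition dX (a : A) : dualX := mk_hom (ev_ll a).

Lemma dX_lin : linear dX.
Proof. by move=> c a b; apply: hom_ext => u; rewrite happP; apply: vapp_lin. Qed.

Lemma ha_dX h a : ha h (dX a) = dX (act h a).
Proof.
apply: hom_ext => u.
rewrite -[LHS]/(happ (hom_ha h (dX a)) u) hom_haE -[RHS]/(vapp u (act h a)).
have lv (U : lmodType k) (g : U -> A) : linear g -> linear (fun x => vapp u (g x)).
  by apply: lin_app; apply: vapp_lin.
pose F c d y : A := act (y * T d) (vapp u (act c a)).
transitivity (\sw_(x, y <- cop h) \sw_(c, d <- cop x) F c d y).
  apply: tlift_eq => x y.
  rewrite -[X in ha _ X]/(endo_ha (T x) (vapp u) a) /endo_ha.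
  rewrite (antiV_cop (F := fun p q => act p (vapp u (act (anti q) a)))); last first.
    by repeat first [lin_step | apply: lv].
  rewrite -[LHS]/(act y _) (tlift_app _ _ (@act_lin _ _ _ y)).
  by apply: tlift_eq => c d; rewrite antiVK -actM.
rewrite coassocE; [|by move=> *; rewrite /F; repeat first [lin_step | apply: lv]..].
apply: (counitrE (F := fun c => vapp u (act c a))); first by apply: lv; lin.
move=> c z; apply: (antiVrE (F := fun t => act t (vapp u (act c a)))) => //.
  by lin.
by rewrite act1.
Qed.

(* A dA : the finite sums of the a db *)
Definition is_form (w : dualX) : Prop :=
  exists s : seq (A * A), w = \sum_(p <- s) la p.1 (dX p.2).
Lemma form_closed : submod_closed (fun w => `[< is_form w >]).
Proof.
apply: mk_closed; first by exists [::]; rewrite big_nil.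
move=> c _ _ [s ->] [t ->].
exists ([seq (c *: p.1, p.2) | p <- s] ++ t).
rewrite big_cat big_map /= scaler_sumr; congr (_ + _); apply: eq_bigr => p _.
have [l _] := la_bilin dualX; exact: esym (linZ (l (dX p.2)) c p.1).
Qed.
Definition form_sub : submodule dualX := Submodule form_closed.
Lemma form_d (a b : A) : sm_mem form_sub (la a (dX b)).
Proof. by apply/asboolP; exists [:: (a, b)]; rewrite big_seq1. Qed.
Lemma form_sum (I : Type) (s : seq I) (F : I -> dualX) :
  (forall i, sm_mem form_sub (F i)) -> sm_mem form_sub (\sum_(i <- s) F i).
Proof.
have [D0 DD] := form_closed.
move=> DF; elim/big_ind: _ => // x y Dx Dy; rewrite -[x]scale1r; exact: DD.
Qed.
Lemma form_la a w : sm_mem form_sub w -> sm_mem form_sub (la a w).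
Proof.
move=> /asboolP[s ->]; rewrite (lin_sum (@la_lin _ _ _ dualX a)).
by apply: form_sum => p; rewrite -laA; apply: form_d.
Qed.
Lemma form_ha h w : sm_mem form_sub w -> sm_mem form_sub (ha h w).
Proof.
move=> /asboolP[s ->]; rewrite (lin_sum (@ha_lin _ _ _ dualX h)).
apply: form_sum => p; rewrite ha_la; apply: sm_tlift => x y.
by rewrite ha_dX; apply: form_d.
Qed.
Definition Omega : sbimod A := sub_bimod form_la form_ha.
Definition pairing (u : X) (w : Omega) : A := happ (\val w : dualX) u.
Lemma form_d1 (a : A) : sm_mem form_sub (dX a).
Proof. by rewrite -[dX a]la1; apply: form_d. Qed.
Definition dA (a : A) : Omega := sm_mk (D := form_sub) (form_d1 a).

Definition Om (r : nat) : sbimod A := Alt Omega r.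

(* The extension of d : A -> Omega(A) to all forms; A and Omega(A) enter as Om 0
   and Om 1 through alt. *)
Record exterior_derivative (d : forall r, Om r -> Om r.+1) : Prop := {
  ed_linear : forall r, linear (@d r);
  ed_equivariant : forall r h (w : Om r), d r (ha h w) = ha h (d r w);
  ed_functions : forall a : A, d 0 (alt (V := Omega) (r := 0) a)
    = alt (V := Omega) (r := 1) (dA a);
  ed_square : forall r (w : Om r), d r.+1 (d r w) = 0;
  ed_leibniz : forall r s (w : Om r) (w' : Om s),
    d (r + s)%N (wedge w w') =
      wedge (d r w) w' + (-1) ^+ r *: cast_alt (addnS r s) (wedge w (d s w'))
}.

(* The map w (x) t |-> <u, w> t on tensor powers; i_u is its restriction to
   antisymmetric tensors, which this map sends to antisymmetric tensors. *)
Definition ins (u : X) (n : nat) : Tpow Omega n -> Tpow Omega n.-1 :=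
  match n return Tpow Omega n -> Tpow Omega n.-1 with
  | 0 => fun _ => 0
  | m.+1 =>
    match m return Tpow Omega m.+1 -> Tpow Omega m with
    | 0 => fun w => pairing u w
    | m'.+1 => fun t => \sw_(w, t' <- (t : tensor Omega (Tpow Omega m'.+1)))
        la (pairing u w) t'
    end
  end.

Section Conn.
Variable G : sbimod A.
Definition left_connection (nabla : G -> tensor Omega G) : Prop :=
  linear nabla /\ forall a s, nabla (la a s) = ten (dA a) s + la a (nabla s).

(* w /\ (eta (x) s) = (w /\ eta) (x) s *)
Definition wedge_conn r (w : Om r) (t : tensor Omega G) : tensor (Om r.+1) G :=
  \sw_(eta, s <- t)
    ten (cast_alt (addn1 r) (wedge w (alt (V := Omega) (r := 1) eta))) s.

Definition dconn (d : forall r, Om r -> Om r.+1) (nabla : G -> tensor Omega G)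
    (r : nat) (t : tensor (Om r) G) : tensor (Om r.+1) G :=
  \sw_(w, s <- t) (ten (d r w) s + (-1) ^+ r *: wedge_conn w (nabla s)).

Definition ins_conn (u : X) (n : nat) (t : tensor (Tpow Omega n) G) :
    tensor (Tpow Omega n.-1) G := \sw_(w, s <- t) ten (ins u w) s.
Definition incl_conn (r : nat) (t : tensor (Om r) G) : tensor (Tpow Omega r) G :=
  \sw_(w, s <- t) ten (alt_val w) s.
(* A (x)_A G = G *)
Definition lunit (t : tensor (Tpow Omega 0) G) : G := \sw_(a, s <- t) la (a : A) s.
Definition nabla_at (nabla : G -> tensor Omega G) (u : X) (s : G) : G :=
  lunit (ins_conn (n := 1) u (nabla s)).
End Conn.

Definition torsion (nabla : X -> tensor Omega X) (u v : X) : X :=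
  nabla_at nabla u v - \sw_(x, y <- Rinv H) nabla_at nabla (ha x v) (ha y u)
  - bracket u v.

Lemma mor_antisym2 : bim_mor (fun t : tensor X X => 2%:R^-1 *: (t - tau t)).
Proof. by apply: mor_scale; apply: mor_sub; [apply: mor_id | apply: mor_tau]. Qed.
(* X^2(A); wedgeX u v below is an element of it since 2 is invertible. *)
Definition X2 : sbimod A := im_bimod mor_antisym2.
Definition wedgeX (u v : X) : tensor X X :=
  ten u v - \sw_(x, y <- Rinv H) ten (ha x v) (ha y u).
End Forms.

Definition char0_field (k : comUnitRingType) : Prop :=
  (forall x : k, x != 0 -> x \is a GRing.unit) /\ [pchar k] =i pred0.
(* k is isomorphic to K[[h]], c x n being the coefficient of h^n in x. *)
Definition char0_fps (k : comUnitRingType) : Prop :=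
  exists (K : fieldType) (c : k -> nat -> K),
    [/\ [pchar K] =i pred0, bijective c, forall n, c 1 n = (n == 0)%:R,
        forall x y n, c (x + y) n = c x n + c y n
      & forall x y n, c (x * y) n = \sum_(i < n.+1) c x i * c y (n - i)%N].

Section Projective.
Variables (k : comUnitRingType) (H : triHopf k) (A : bcModAlg H) (V : sbimod A).
Definition fg : Prop := exists (n : nat) (g : 'I_n -> V),
  forall v, exists c : 'I_n -> A, v = \sum_i la (c i) (g i).
Definition left_mod_hom (M : lmodType A) (f : V -> M) : Prop :=
  (forall v w, f (v + w) = f v + f w) /\ forall a v, f (la a v) = a *: f v.
Definition projective : Prop :=
  forall (M N : lmodType A) (p : {linear M -> N}) (f : V -> N),
    (forall y, exists x, p x = y) -> left_mod_hom f ->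
    exists2 f' : V -> M, left_mod_hom f' & forall v, p (f' v) = f v.
End Projective.

(* Main.v *)
Require Import Defs.
From mathcomp Require Import all_boot fingroup perm ssralg.
From mathcomp Require Import generic_quotient boolp.

Set Implicit Arguments.
Unset Strict Implicit.
Unset Printing Implicit Defensive.

Import GRing.Theory.
Local Open Scope ring_scope.

(** Why the theorem holds. The form-valued field d_nabla(omega (x) s) is balanced
    over A by the Leibniz rules, so d_nabla(I) may be computed from any
    expression of I as a sum of pure tensors. Since Omega(A) = A dA and the
    bimodule is symmetric, Omega(A) = dA A as well, and coefficients move across
    the tensor product: I = sum_j db_j (x) s_j ([tensor_dA_span]). In this form
    d_nabla(I) = - sum_j db_j /\ nabla(s_j), because d(db_j) = 0 ([dconn_dA]),
    and the dual basis property becomes sum_j u(b_j) s_j = u for every field u.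

    Contracting one term is an R-matrix computation ([contract_wedge]): for any
    t in Omega(A) (x) X(A), and Rbar = R^a (x) R_a,

      i_u i_v (db /\ t) = i_u(v(b) t) - i_(R^a |> v)((R_a |> u)(b) t),

    because the pairing is H-equivariant and Rbar satisfies the hexagon
    identities ([pairing_exchange]). For t = nabla(s), the Leibniz rule of nabla
    gives i_u(a nabla(s)) = nabla_u(a s) - u(a) s. Summing over j, the covariant
    derivatives add up to nabla_u v - nabla_(R^a |> v)(R_a |> u), and the other
    terms to [u, v]. This is the torsion formula ([torsion_formula]).

    The formula makes the torsion balanced and left A-linear, because
    i_(ua) i_v = i_u i_(av); these are the properties that its definition by
    nabla does not show. It therefore descends to X(A) (x)_A X(A), where it is
    odd under tau, since its definition is a braided commutator and R is
    triangular ([braided_commutator_antisym]). Hence it takes the value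
    2 T(u, v) on u /\ v. As 2 is invertible, the elements u /\ v span X^2(A), so
    the induced left A-linear map is the only one. *)

(** * Pairing of vector fields with one-forms *)

Section Pairing.
Variables (k : comUnitRingType) (H : triHopf k) (A : bcModAlg H).
Notation X := (VF A).
Notation Om1 := (Omega A).

Lemma lin_pairl (U : lmodType k) (g : U -> X) (w : Om1) : linear g ->
  linear (fun x => pairing (g x) w).
Proof.
apply: (lin_app (f := fun u => pairing u w)).
exact: (@happ_lin _ _ _ X (regular A) (val w)).
Qed.
Lemma lin_pairr (U : lmodType k) (g : U -> Om1) (u : X) : linear g ->
  linear (fun x => pairing u (g x)).
Proof.
apply: (lin_app (f := fun w => pairing u w)) => c w w'.
exact: (@happP _ _ _ X (regular A) c (val w) (val w') u).
Qed.
Lemma lin_vappl (U : lmodType k) (g : U -> X) (a : A) : linear g ->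
  linear (fun x => vapp (g x) a).
Proof. by apply: (lin_app (f := fun u : X => vapp u a)). Qed.
Lemma lin_vappr (U : lmodType k) (g : U -> A) (u : X) : linear g ->
  linear (fun x => vapp u (g x)).
Proof. by apply: lin_app; apply: vapp_lin. Qed.

Lemma pairing_la_vf a u w : pairing (la a u : X) w = a * pairing u w.
Proof. exact: (@happ_la _ _ _ X (regular A) (val w)). Qed.
Lemma pairing_la u a w : pairing u (la a w : Om1) = pairing (ra u a) w.
Proof. by []. Qed.
Lemma pairing_ra u w a : pairing u (ra w a : Om1) = pairing u w * a.
Proof. by []. Qed.
Lemma pairing_dA u (a : A) : pairing u (dA a) = vapp u a.
Proof. by []. Qed.
Lemma ha_dA h (a : A) : ha h (dA a) = dA (act h a).
Proof. by apply: val_inj; apply: ha_dX. Qed.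
End Pairing.

Ltac plin := repeat first
  [ apply: lin_tenl | apply: lin_tenr | apply: lin_pairl | apply: lin_pairr
  | apply: lin_vappl | apply: lin_vappr | lin_step ].

Section Equivariance.
Variables (k : comUnitRingType) (H : triHopf k) (A : bcModAlg H).
Notation X := (VF A).
Notation Om1 := (Omega A).
Notation Rb := (Rinv H).

(** The action on forms by h_(2) o L o S^-1(h_(1)) is the one for which evaluation
    is equivariant with the vector field on the left: the factor S^-1(h_(2)) h_(1)
    cancels. *)
Lemma act_pairing h (u : X) (w : Om1) :
  act h (pairing u w) = \sw_(x, y <- cop h) pairing (ha x u) (ha y w).
Proof.
symmetry.
transitivity (\sw_(x, y <- cop h) \sw_(p, q <- cop y)
    act q (pairing (ha (antiV p * x) u) w)).
  apply: tlift_eq => x y; rewrite /pairing -[LHS]/(happ (hom_ha y (val w)) (ha x u)).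
  by rewrite hom_haE; apply: tlift_eq => p q; rewrite haM.
rewrite -(coassocE (F := fun x p q => act q (pairing (ha (antiV p * x) u) w)));
  [|by move=> *; plin..].
apply: (counitlE (F := fun q => act q (pairing u w))); first by plin.
move=> z q; apply: (antiVlE (F := fun t => act q (pairing (ha t u) w))) => //.
  by plin.
by rewrite ha1.
Qed.

(** Starting from the order u, v, b, w, the left side moves w in front of b and
    then the pair (v, w) in front of u; the right side moves v in front of u and
    then w in front of the function u(b). The two hexagon identities turn each of
    them into the same sum over three copies of Rbar. *)
Lemma pairing_exchange (u v : X) (b : A) (w : Om1) :
  \sw_(x, y <- Rb) \sw_(p, q <- Rb)
     (act p (pairing v (ha x w)) * vapp (ha q u) (act y b)) =
  \sw_(p, q <- Rb) pairing (ha p v) (la (vapp (ha q u) b) w).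
Proof.
transitivity (\sw_(x, y <- Rb) \sw_(p, q <- Rb) \sw_(r, s <- Rb)
   (pairing (ha r v) (ha (p * x) w) * vapp (ha (q * s) u) (act y b))).
  apply: tlift_eq => x y.
  rewrite -(Rinv_copl (F := fun r p q =>
     pairing (ha r v) (ha (p * x) w) * vapp (ha q u) (act y b)));
    [|by move=> *; plin..].
  apply: tlift_eq => p q; rewrite act_pairing.
  rewrite (tlift_app _ _ (f := fun z => z * vapp (ha q u) (act y b))); last by plin.
  by apply: tlift_eq => c d; rewrite haM.
transitivity (\sw_(r, s <- Rb) \sw_(p, q <- Rb) \sw_(x, y <- Rb)
   (pairing (ha r v) (ha (p * x) w) * vapp (ha (q * s) u) (act y b))).
  under tlift_eq => x y do rewrite exch_tlift.
  by rewrite exch_tlift; apply: tlift_eq => r s; rewrite exch_tlift.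
apply: tlift_eq => r s.
rewrite -(Rinv_copr (F := fun x p q =>
   pairing (ha r v) (ha x w) * vapp (ha (p * s) u) (act q b))); [|by move=> *; plin..].
rewrite la_sym.
rewrite (tlift_app _ _ (f := fun z => pairing (ha r v) z)); last by plin.
apply: tlift_eq => x y; rewrite pairing_ra act_vapp.
rewrite (tlift_app _ _ (f := fun z => pairing (ha r v) (ha x w) * z)); last by plin.
by apply: tlift_eq => c d; rewrite haM.
Qed.
End Equivariance.

(** * Alternating tensors of degree at most two *)

(** For formal power series the inverse is the constant series 1/2. *)
Lemma char0_two_unit (k : comUnitRingType) : char0_field k \/ char0_fps k ->
  (2%:R : k) \is a GRing.unit.
Proof.
case=> [[kU k0]|[K [c [K0 [g gK cK] c1 cD cM]]]].
  by apply: kU; apply/negP => two0; have := k0 2%N; rewrite inE /= two0.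
have two_neq0 : (2%:R : K) != 0.
  by apply/negP => two0; have := K0 2%N; rewrite inE /= two0.
pose y := g (fun n => (n == 0%N)%:R / 2%:R).
apply/unitrP; exists y; suff E : 2%:R * y = 1 by rewrite mulrC.
apply: (can_inj gK); apply/funext => n.
by rewrite mulr_natl mulr2n cD !cK c1 -mulr2n -[_ *+ 2]mulr_natr divfK.
Qed.

Section Degree2.
Variables (k : comUnitRingType) (H : triHopf k) (A : bcModAlg H) (V W : sbimod A).

(** A triangular R-matrix makes the braiding a symmetry. *)
Lemma tauK (t : tensor V W) : tau (tau t) = t.
Proof.
have [ltau _ _] := mor_tau V W; have [ltau' _ _] := mor_tau W V.
apply: (tensor_ext (f := fun t => tau (tau t)) (g := id)) => //.
  exact: lin_app.
move=> v w; rewrite tau_ten (tlift_app _ _ ltau').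
under tlift_eq => x y do rewrite tau_ten.
rewrite exch_tlift.
transitivity (\sw_(t, u <- Rinv H) \sw_(p, q <- Rinv H)
   (ten (ha (t * q) v) (ha (u * p) w) : tensor V W)).
  by do 2!(apply: tlift_eq => ? ?); rewrite !haM.
by rewrite (Rinv_flip (F := fun x y => ten (ha x v) (ha y w))) ?ha1 //; plin.
Qed.
End Degree2.

Section Degree2Alt.
Variables (k : comUnitRingType) (H : triHopf k) (A : bcModAlg H) (V : sbimod A).

Lemma antisym2 (t : Tpow V 2) :
  antisym (r := 2) t = 2%:R^-1 *: (t - tau (t : tensor V V)).
Proof.
(* tau is an involution, so only the parity of the length of a word matters *)
have PermE (s : 'S_2) : Defs.Perm s t = if odd_perm s then tau (t : tensor V V) else t.
  rewrite /Defs.Perm; have /eqP := xchooseP (adj_gen s).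
  rewrite -[xchoose _]/(adj_word s); move: (adj_word s) => w0.
  elim: w0 s => [|i w IHw] s /=; first by rewrite big_nil => <-; rewrite odd_perm1.
  rewrite big_cons => <-; rewrite (IHw _ erefl) odd_permM.
  have -> : odd_perm (adj i) by rewrite /adj odd_tperm -val_eqE /= [i]ord1.
  rewrite [i]ord1 /=; case: (odd_perm _) => //=.
  exact: tauK.
rewrite /antisym; congr (_ *: _).
rewrite (bigD1 1%g) //= (bigD1 (tperm ord0 ord_max)) /=; last first.
  by apply/eqP => E; have := odd_perm1 'I_2; rewrite -E odd_tperm.
rewrite big1 ?addr0 => [|s /andP[s1 s2]].
  by rewrite !PermE odd_perm1 odd_tperm /= expr0 expr1 scale1r scaleN1r.
suff : s \in [set 1%g; tperm ord0 ord_max] by rewrite !inE (negPf s1) (negPf s2).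
have -> : [set 1%g; tperm ord0 ord_max] = [set: 'S_2].
  apply/eqP; rewrite eqEcard subsetT cardsT card_Sn cards2.
  by case: eqP => // E; have := odd_perm1 'I_2; rewrite E odd_tperm.
by rewrite inE.
Qed.

Lemma alt_val_mor r : bim_mor (@alt_val _ _ A V r).
Proof. by []. Qed.

Lemma alt_mor r : bim_mor (@alt _ _ A V r).
Proof.
have [l la_ ha_] := mor_antisym V r.
by split=> [c s t|a t|h t]; apply: val_inj; [exact: l|exact: la_|exact: ha_].
Qed.

Lemma alt_valK1 : cancel (@alt_val _ _ A V 1) (@alt _ _ A V 1).
Proof. by move=> w; apply: val_inj; apply: antisym1. Qed.

Lemma altK1 : cancel (@alt _ _ A V 1) (@alt_val _ _ A V 1).
Proof. by move=> w; apply: antisym1. Qed.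

Hypothesis two_unit : (2%:R : k) \is a GRing.unit.

(** A_2 is idempotent: its image lies in the (-1)-eigenspace of tau. *)
Lemma alt_valK2 : cancel (@alt_val _ _ A V 2) (@alt _ _ A V 2).
Proof.
have [l _ _] := mor_tau V V.
move=> w; apply: val_inj; rewrite -[LHS]/(antisym (alt_val w)).
have /asboolP[t Et] := valP w; rewrite -[\val w]/(alt_val w) in Et *.
rewrite Et !antisym2; set s := t - tau _.
have -> : tau (2%:R^-1 *: s : tensor V V) = - (2%:R^-1 *: s).
  by rewrite (linZ l) /s (linD l) (linN l) tauK -scalerN opprB addrC.
by rewrite opprK -mulr2n -scaler_nat scalerA mulVr // scale1r.
Qed.

Lemma cast_altE m (e : m = m) (x : Alt V m) : cast_alt e x = x.
Proof. by rewrite /cast_alt (eq_irrelevance e erefl). Qed.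

(** The factor 2 = 2!/(1! 1!) of the wedge product cancels the 1/2 of A_2, so this
    is v (x) w - tau(v (x) w). *)
Definition wedge1 (v w : V) : Alt V 2 := 2%:R *: alt (r := 2) (ten v w).

Lemma wedge_alt1 (x : Alt V 1) (w : V) (e : (1 + 1 = 2)%N) :
  cast_alt e (wedge x (alt (r := 1) w)) = wedge1 (alt_val x) w.
Proof.
rewrite cast_altE /wedge /wedge1 altK1; congr (_ *: _).
by rewrite -[1`!]/1%N mulr1 invr1 mulr1.
Qed.
Lemma alt_val_wedge1 (v w : V) :
  alt_val (wedge1 v w) = ten v w - tau (ten v w).
Proof.
have [l _ _] := alt_val_mor 2; rewrite /wedge1 (linZ l) -[alt_val _]/(antisym _).
by rewrite antisym2 scalerA divrr // scale1r.
Qed.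

End Degree2Alt.

(** * The exterior covariant derivative on one-forms *)

Section Wedge0.
Variables (k : comUnitRingType) (H : triHopf k) (A : bcModAlg H) (V : sbimod A).
Hypothesis two_unit : (2%:R : k) \is a GRing.unit.

Lemma wedge_fun1 (x : Alt V 1) (b : A) :
  wedge x (alt (V := V) (r := 0) b) = ra x b :> Alt V 1.
Proof.
(* each of the three factorials in the coefficient is convertible to 1 *)
rewrite /wedge -[(1 + 0)`!]/1%N mulr1 invr1 mulr1 scale1r.
rewrite -[tcat _ _]/(ra (alt_val x) b : Tpow V 1).
by rewrite -(mor_ra (alt_val_mor V 1)) alt_valK1.
Qed.
Lemma wedge_fun2 (x : Alt V 2) (b : A) :
  wedge x (alt (V := V) (r := 0) b) = ra x b :> Alt V 2.
Proof.
rewrite /wedge -[(2 + 0)`!]/2%N -[0`!]/1%N mulr1 divrr // scale1r.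
rewrite -[tcat _ _]/(ra (alt_val x) b : Tpow V 2).
by rewrite -(mor_ra (alt_val_mor V 2)) alt_valK2.
Qed.

Lemma wedge1_bilin : bilin (@wedge1 _ _ A V).
Proof.
have [l _ _] := alt_mor V 2.
by split=> ?; rewrite /wedge1; apply: lin_scale; apply: lin_app => //; plin.
Qed.
Lemma wedge1_ra v w b : wedge1 v (ra w b : V) = ra (wedge1 v w) b.
Proof.
by rewrite /wedge1 -ten_ra (mor_ra (alt_mor V 2)) (linZ (@ra_lin _ _ _ _ b)).
Qed.
Lemma wedge1_bal v w b : wedge1 (ra v b : V) w = wedge1 v (la b w).
Proof. by rewrite /wedge1 ten_bal. Qed.
End Wedge0.

Section CovDer.
Variables (k : comUnitRingType) (H : triHopf k) (A : bcModAlg H) (G : sbimod A).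
Hypothesis two_unit : (2%:R : k) \is a GRing.unit.
Variables (d : forall r, Om A r -> Om A r.+1) (d_ext : exterior_derivative d).
Variables (nabla : G -> tensor (Omega A) G) (nabla_conn : left_connection nabla).

(** The graded Leibniz rule for the product of a one-form and a function. *)
Lemma d_ra (w : Om A 1) (b : A) :
  @d 1 (ra w b) = ra (@d 1 w) b - wedge1 (alt_val w) (dA b).
Proof.
rewrite -wedge_fun1 -wedge_fun2 // -[wedge w _]/(wedge (r := 1) (s := 0) w _).
have := ed_leibniz d_ext (r := 1) (s := 0) w (alt (V := Omega A) (r := 0) b).
rewrite (ed_functions d_ext) expr1 scaleN1r wedge_alt1; exact.
Qed.

Lemma d_dA (a : A) : @d 1 (alt (V := Omega A) (r := 1) (dA a)) = 0.
Proof. by rewrite -(ed_functions d_ext) (ed_square d_ext). Qed.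

Lemma wedge_connE (w : Om A 1) (t : tensor (Omega A) G) :
  wedge_conn w t = \sw_(eta, s <- t) ten (wedge1 (alt_val w) eta) s.
Proof. by apply: tlift_eq => eta s; rewrite wedge_alt1. Qed.

Lemma wedge_conn_bal (w : Omega A) : balanced (@ra _ _ _ (Omega A)) (@la _ _ _ G)
  (fun eta s => ten (wedge1 w eta) s).
Proof.
have [_ lr] := wedge1_bilin (Omega A).
split=> [s|eta|eta b s]; [by apply: lin_tenl|by apply: lin_tenr|].
by rewrite wedge1_ra ten_bal.
Qed.
Lemma wedge_conn_lin (w : Om A 1) : linear (wedge_conn (G := G) w).
Proof.
move=> c s t; rewrite !wedge_connE.
exact: (tlift_linear (wedge_conn_bal (alt_val w))).
Qed.
Lemma wedge_conn_linl (t : tensor (Omega A) G) : linear ((@wedge_conn _ _ _ _ 1)^~ t).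
Proof.
have [ll _] := wedge1_bilin (Omega A).
move=> c s s'; rewrite !wedge_connE.
apply: (_ : linear (fun w : Om A 1 =>
  \sw_(eta, s <- t) (ten (wedge1 (alt_val w) eta) s : tensor (Om A 2) G))).
apply: lin_tliftc => eta z; apply: lin_tenl.
by apply: (lin_app (f := @wedge1 _ _ _ _ ^~ _)).
Qed.
Lemma wedge_conn_ten (w : Om A 1) (eta : Omega A) (s : G) :
  wedge_conn w (ten eta s) = ten (wedge1 (alt_val w) eta) s.
Proof. by rewrite wedge_connE tlift_ten //; apply: wedge_conn_bal. Qed.
Lemma wedge_conn_ra (w : Om A 1) b (t : tensor (Omega A) G) :
  wedge_conn (ra w b) t = wedge_conn w (la b t).
Proof.
move: t; apply: (tensor_ext (g := fun t => wedge_conn w (la b t))).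
- exact: wedge_conn_lin.
- by apply: lin_app; [exact: wedge_conn_lin|exact: la_lin].
move=> eta s; rewrite ten_la !wedge_conn_ten -wedge1_bal.
by rewrite -(mor_ra (alt_val_mor (Omega A) 1)).
Qed.

(** Moving b across the tensor product changes d w (x) s by - w /\ db (x) s, which
    is what the Leibniz rule of nabla contributes to w /\ nabla(b s). *)
Lemma dconn_bal : balanced (@ra _ _ _ (Om A 1)) (@la _ _ _ G)
  (fun w s => ten (@d 1 w) s + (-1) ^+ 1 *: wedge_conn w (nabla s)).
Proof.
have [ln nl] := nabla_conn.
have ld := ed_linear d_ext.
split=> [s|w|w b s].
- apply: lin_add; first exact: lin_tenl.
  by apply: lin_scale; apply: wedge_conn_linl.
- apply: lin_add; first exact: lin_tenr.
  by apply: lin_scale; apply: lin_app => //; apply: wedge_conn_lin.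
rewrite !expr1 !scaleN1r nl (linD (wedge_conn_lin w)) wedge_conn_ten wedge_conn_ra.
rewrite d_ra -ten_bal.
have ls : linear (fun x => ten x s : tensor (Om A 2) G) by apply: lin_tenl.
by rewrite (linD ls) (linN ls) opprD addrA.
Qed.

Lemma dconn_linear : linear (dconn d nabla (r := 1)).
Proof. exact: tlift_linear dconn_bal. Qed.

Lemma dconn_dA (a : A) (s : G) :
  dconn d nabla (ten (alt (V := Omega A) (r := 1) (dA a)) s) =
  - wedge_conn (alt (V := Omega A) (r := 1) (dA a)) (nabla s).
Proof.
rewrite /dconn (tlift_ten _ _ dconn_bal) d_dA expr1 scaleN1r.
by rewrite (lin0 (f := fun x => ten x s : tensor (Om A 2) G)) ?add0r //; apply: lin_tenl.
Qed.
End CovDer.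

(** * Contractions and the torsion *)

Section Contraction.
Variables (k : comUnitRingType) (H : triHopf k) (A : bcModAlg H) (G : sbimod A).
Notation X := (VF A).
Notation Om1 := (Omega A).
Notation Rb := (Rinv H).
Notation tbal V W f := (balanced (@ra _ _ _ V) (@la _ _ _ W) f).

Lemma ins2_bal (u : X) : tbal Om1 Om1 (fun w eta => la (pairing u w) eta).
Proof.
split=> [eta|w|w b eta]; [by plin|by plin|].
by rewrite pairing_ra laA.
Qed.
Lemma ins2_ten (u : X) (w eta : Om1) :
  ins u (n := 2) (ten w eta) = la (pairing u w) eta.
Proof. exact: (tlift_ten _ _ (ins2_bal u)). Qed.
Lemma ins2_lin (u : X) : linear (ins u (n := 2)).
Proof. exact: (tlift_linear (ins2_bal u)). Qed.
Lemma ins2_ra (u : X) (t : Tpow Om1 2) b : ins u (n := 2) (ra t b) = ra (ins u t) b.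
Proof.
move: t; apply: (tensor_ext (f := fun t => ins u (n := 2) (ra t b))
  (g := fun t => ra (ins u (n := 2) t) b)).
- by apply: lin_app; [exact: ins2_lin|exact: ra_lin].
- by apply: (lin_app (f := fun t : Om1 => ra t b)); [exact: ra_lin|exact: ins2_lin].
by move=> w eta; rewrite ten_ra !ins2_ten laraA.
Qed.
Lemma ins2_la (u : X) (a : A) (t : Tpow Om1 2) :
  ins (la a u) t = la a (ins u t).
Proof.
move: t; apply: (tensor_ext (f := ins (la a u) (n := 2))
  (g := fun t => la a (ins u (n := 2) t))).
- exact: ins2_lin.
- by apply: lin_app; [exact: la_lin|exact: ins2_lin].
by move=> w eta; rewrite !ins2_ten pairing_la_vf laA.
Qed.

Definition contract1 (u : X) (t : tensor Om1 G) : G := lunit (ins_conn (n := 1) u t).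

Lemma lunit_bal : tbal (Tpow Om1 0) G (fun a s => la (a : A) s).
Proof. by split=> [s|a|a b s]; [exact: lin_lal|exact: lin_lar|exact: laA]. Qed.
Lemma lunit_lin : linear (@lunit _ _ A G).
Proof. exact: tlift_linear lunit_bal. Qed.

Lemma ins1_bal (u : X) : tbal (Tpow Om1 1) G
  (fun w s => ten (ins u w) s : tensor (Tpow Om1 0) G).
Proof.
split=> [s|w|w b s].
- by apply: lin_tenl; apply: (lin_pairr u).
- by plin.
- exact: (ten_bal (V := regular A) b (pairing u w) s).
Qed.
Lemma ins2_conn_bal (u : X) : tbal (Tpow Om1 2) G
  (fun w s => ten (ins u w) s : tensor (Tpow Om1 1) G).
Proof.
split=> [s|w|w b s]; [apply: lin_tenl; exact: ins2_lin|by plin|].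
by rewrite ins2_ra ten_bal.
Qed.
Lemma contract1_linear u : linear (contract1 u).
Proof. by apply: lin_app; [exact: lunit_lin|exact: tlift_linear (ins1_bal u)]. Qed.
Lemma contract1_ten u w s : contract1 u (ten w s) = la (pairing u w) s.
Proof.
rewrite /contract1 /ins_conn (tlift_ten _ _ (ins1_bal u)).
exact: (tlift_ten _ _ lunit_bal).
Qed.
Lemma contract1_linearl t : linear (contract1^~ t).
Proof.
apply: (lin_app (f := @lunit _ _ A G)); first exact: lunit_lin.
rewrite /ins_conn; apply: lin_tliftc => w s; apply: lin_tenl; exact: lin_pairl.
Qed.

Definition contract2 (u v : X) (t : tensor (Om A 2) G) : G :=
  contract1 u (ins_conn v (incl_conn t)).

Lemma incl_bal r : tbal (Om A r) G (fun w s => ten (alt_val w) s).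
Proof.
split=> [s|w|w b s]; [by apply: lin_tenl|by plin|].
by rewrite (mor_ra (alt_val_mor Om1 r)) ten_bal.
Qed.
Lemma contract2_linear u v : linear (contract2 u v).
Proof.
apply: lin_app; first exact: contract1_linear.
apply: lin_app; first exact: tlift_linear (ins2_conn_bal v).
exact: tlift_linear (@incl_bal 2).
Qed.
Lemma contract2_ten u v (t : Om A 2) s :
  contract2 u v (ten t s) = la (pairing u (ins v (alt_val t))) s.
Proof.
rewrite /contract2 /incl_conn (tlift_ten _ _ (@incl_bal 2)) /ins_conn.
by rewrite (tlift_ten _ _ (ins2_conn_bal v)) contract1_ten.
Qed.

Hypothesis two_unit : (2%:R : k) \is a GRing.unit.

(** The braided antisymmetry of db /\ eta produces the second term; the rest is
    the exchange identity for the pairing. *)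
Lemma contract_wedge u v (b : A) (t : tensor Om1 G) :
  contract2 u v (wedge_conn (alt (V := Om1) (r := 1) (dA b)) t) =
  contract1 u (la (vapp v b) t) -
  \sw_(p, q <- Rb) contract1 (ha p v) (la (vapp (ha q u) b) t).
Proof.
move: t; apply: (tensor_ext (f := fun t =>
    contract2 u v (wedge_conn (alt (V := Om1) (r := 1) (dA b)) t))
  (g := fun t => contract1 u (la (vapp v b) t) -
  \sw_(p, q <- Rb) contract1 (ha p v) (la (vapp (ha q u) b) t))).
- by apply: lin_app; [exact: contract2_linear|exact: wedge_conn_lin].
- have lc w a : linear (fun t : tensor Om1 G => contract1 w (la a t)).
    by apply: lin_app; [exact: contract1_linear|exact: la_lin].
  by apply: lin_add => //; apply: lin_opp; apply: lin_tliftc.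
move=> eta s; rewrite wedge_conn_ten // contract2_ten alt_val_wedge1 // altK1.
have ll : linear (fun x : Om1 => pairing u x) by plin.
have ls : linear (fun a : A => la a s) by plin.
rewrite (linD (ins2_lin v)) (linN (ins2_lin v)) ins2_ten pairing_dA.
rewrite (linD ll) (linN ll) (linD ls) (linN ls) ten_la contract1_ten; congr (_ - _).
under [RHS]tlift_eq => p q do rewrite ten_la contract1_ten.
rewrite -(tlift_app (fun p q => pairing (ha p v) (la (vapp (ha q u) b) eta)) _ ls).
rewrite -pairing_exchange.
congr (la _ s).
rewrite tau_ten (tlift_app _ _ (ins2_lin v)) (tlift_app _ _ ll).
apply: tlift_eq => x y; rewrite ins2_ten ha_dA pairing_la raE.
rewrite (tlift_app _ _ (f := fun z => pairing z (dA (act y b)))); last by plin.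
by apply: tlift_eq => p q; rewrite pairing_la_vf.
Qed.

(** A form a db equals the sum of the d(R^a |> b) (R_a |> a) by symmetry of the
    bimodule, and the right coefficient is absorbed by the second factor. *)
Lemma tensor_dA_span (t : tensor Om1 G) :
  exists s : seq (A * G), t = \sum_(p <- s) ten (dA p.1) p.2.
Proof.
pose P (t : tensor Om1 G) := exists s : seq (A * G), t = \sum_(p <- s) ten (dA p.1) p.2.
have PD x y : P x -> P y -> P (x + y).
  by move=> [s ->] [s' ->]; exists (s ++ s'); rewrite big_cat.
have P0 : P 0 by exists [::]; rewrite big_nil.
suff Pten w s : P (ten w s).
  by rewrite -/(P t) (repr_tpair t); apply: big_ind => // p _; apply: Pten.
have /asboolP[l El] := valP w.
have -> : w = \sum_(p <- l) la p.1 (dA p.2).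
  by apply: val_inj; rewrite El (lin_sum (@sm_lin _ _ (form_sub A))).
rewrite (lin_sum (f := fun w => ten w s : tensor Om1 G)); last by plin.
apply: big_ind => // p _; rewrite la_sym.
rewrite (tlift_app _ _ (f := fun w => ten w s : tensor Om1 G)); last by plin.
rewrite /tlift; apply: big_ind => // q _.
exists [:: (act q.1 p.2, la (act q.2 p.1) s)].
by rewrite big_seq1 -ten_bal -ha_dA.
Qed.
End Contraction.

Section Torsion.
Variables (k : comUnitRingType) (H : triHopf k) (A : bcModAlg H).
Notation X := (VF A).
Notation Om1 := (Omega A).
Notation Rb := (Rinv H).
Notation tbal V W f := (balanced (@ra _ _ _ V) (@la _ _ _ W) f).
Hypothesis two_unit : (2%:R : k) \is a GRing.unit.
Variables (d : forall r, Om A r -> Om A r.+1) (d_ext : exterior_derivative d).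
Variables (nabla : X -> tensor Om1 X) (nabla_conn : left_connection nabla).

Lemma lin_nabla_atl (U : lmodType k) (g : U -> X) s : linear g ->
  linear (fun x => nabla_at nabla (g x) s).
Proof.
by apply: (lin_app (f := fun u => nabla_at nabla u s)); exact: contract1_linearl.
Qed.
Lemma lin_nabla_atr (U : lmodType k) (g : U -> X) u : linear g ->
  linear (fun x => nabla_at nabla u (g x)).
Proof.
have [ln _] := nabla_conn; apply: (lin_app (f := nabla_at nabla u)).
exact: (lin_app (@contract1_linear _ _ _ X u) ln).
Qed.

Lemma contract1_nabla u (a : A) (s : X) :
  contract1 u (la a (nabla s)) = nabla_at nabla u (la a s) - la (vapp u a) s.
Proof.
have [_ nl] := nabla_conn.
rewrite -[nabla_at _ _ _]/(contract1 u (nabla (la a s))) nl.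
by rewrite (linD (contract1_linear u)) contract1_ten pairing_dA [RHS]addrC addKr.
Qed.

(** The torsion formula for a canonical element that is written as a sum of
    db (x) s: the first derivatives of the coefficients b assemble into the
    bracket. *)
Lemma torsion_exact_expansion (s : seq (A * X)) :
  (forall u, \sum_(p <- s) la (vapp u p.1) p.2 = u) ->
  forall u v, torsion nabla u v = - contract2 u v
    (\sum_(p <- s) dconn d nabla (ten (alt (V := Om1) (r := 1) (dA p.1)) p.2)).
Proof.
move=> sum_s u v.
have lc := contract2_linear (G := X) u v.
rewrite (lin_sum lc) -sumrN.
(* the Leibniz rule of nabla collects the coefficients v'(b) in v' *)
have sumP u' v' : \sum_(p <- s) contract1 u' (la (vapp v' p.1) (nabla p.2)) =
    nabla_at nabla u' v' - \sum_(p <- s) la (vapp u' (vapp v' p.1)) p.2.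
  under eq_bigr => p _ do rewrite contract1_nabla.
  rewrite sumrB; congr (_ - _).
  by rewrite -[in RHS](sum_s v') (lin_sum (lin_nabla_atr u' lin_id)).
transitivity (\sum_(p <- s) (contract1 u (la (vapp v p.1) (nabla p.2)) -
    \sw_(x, y <- Rb) contract1 (ha x v) (la (vapp (ha y u) p.1) (nabla p.2)))); last first.
  apply: eq_bigr => p _; rewrite (dconn_dA two_unit d_ext nabla_conn) (linN lc) opprK.
  by rewrite contract_wedge.
rewrite sumrB sumP /tlift exchange_big /=.
under [X in _ = _ - X]eq_bigr => c _ do rewrite sumP.
rewrite sumrB /torsion -[in LHS](sum_s (bracket u v)).
rewrite [X in _ - X = _](_ : _ = \sum_(p <- s) la (vapp u (vapp v p.1)) p.2 -
    \sum_(c <- repr Rb) \sum_(p <- s) la (vapp (ha c.1 v) (vapp (ha c.2 u) p.1)) p.2).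
  by rewrite !opprD addrACA.
rewrite [X in _ = _ - X]exchange_big -sumrB; apply: eq_bigr => p _ /=.
have ll : linear (fun a : A => la a p.2) by plin.
by rewrite -(lin_sum ll) -(linN ll) -(linD ll).
Qed.

Variables (n : nat) (e : 'I_n -> X) (w : 'I_n -> Om1).
Hypothesis dual_bases : forall u, u = \sum_i la (pairing u (w i)) (e i).
Let I : tensor (Om A 1) X := \sum_i ten (alt (V := Om1) (r := 1) (w i)) (e i).

Lemma torsion_formula u v :
  torsion nabla u v = - contract2 u v (dconn d nabla I).
Proof.
have ld := dconn_linear two_unit d_ext nabla_conn.
have ma : bim_mor (alt (V := Om1) (r := 1)) := alt_mor Om1 1.
have [lt _ _] := mor_tmap ma (mor_id X).
have tE x s : tmap (alt (V := Om1) (r := 1)) (fun z : X => z) (ten x s) =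
    ten (alt (r := 1) x) s.
  by rewrite /tmap (tlift_ten _ _ (tmap_bal ma (mor_id X))).
have [s Es] := tensor_dA_span (\sum_i ten (w i) (e i)).
have -> : I = \sum_(p <- s) ten (alt (V := Om1) (r := 1) (dA p.1)) p.2.
  transitivity (tmap (alt (V := Om1) (r := 1)) (fun z : X => z) (\sum_i ten (w i) (e i))).
    by rewrite (lin_sum lt); apply: eq_bigr => i _; rewrite tE.
  by rewrite Es (lin_sum lt); apply: eq_bigr => i _; rewrite tE.
rewrite (lin_sum ld); apply: torsion_exact_expansion => u'.
transitivity (contract1 u' (\sum_(p <- s) ten (dA p.1) p.2 : tensor Om1 X)).
  rewrite (lin_sum (contract1_linear u')); apply: eq_bigr => p _.
  by rewrite contract1_ten.
rewrite -Es (lin_sum (contract1_linear u')) [RHS]dual_bases.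
by apply: eq_bigr => i _; rewrite contract1_ten.
Qed.

Lemma torsion_bilin : bilin (torsion nabla).
Proof.
have lb (u : X) : linear (bracket u).
  move=> c v v'; apply: vf_ext => a; apply: (_ : linear (fun v => bracket_fun u v a)).
  by rewrite /bracket_fun; plin.
have lb' (v : X) : linear (fun u : X => bracket u v).
  move=> c u u'; apply: vf_ext => a; apply: (_ : linear (fun u => bracket_fun u v a)).
  by rewrite /bracket_fun; plin.
split=> x; rewrite /torsion; repeat first
  [exact: lb|exact: lb'|apply: lin_nabla_atl|apply: lin_nabla_atr|lin_step].
Qed.

Lemma contract2_la a u v (t : tensor (Om A 2) X) :
  contract2 (la a u) v t = la a (contract2 u v t).
Proof.
move: t; apply: (tensor_ext (g := fun t => la a (contract2 u v t))).
- exact: contract2_linear.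
- by apply: lin_app; [exact: la_lin|exact: contract2_linear].
by move=> t s; rewrite !contract2_ten pairing_la_vf laA.
Qed.
Lemma contract2_ra a u v (t : tensor (Om A 2) X) :
  contract2 (ra u a) v t = contract2 u (la a v) t.
Proof.
move: t; apply: tensor_ext; [exact: contract2_linear|exact: contract2_linear|].
by move=> t s; rewrite !contract2_ten ins2_la pairing_la.
Qed.

(** From the definition, only linearity over the base ring is visible; that the
    derivatives of a cancel in T(ua, v) = T(u, av) is read off from the formula. *)
Lemma torsion_bal : tbal X X (torsion nabla).
Proof.
have [ll lr] := torsion_bilin.
by split=> // u b v; rewrite !torsion_formula contract2_ra.
Qed.

Lemma torsion_la a u v : torsion nabla (la a u) v = la a (torsion nabla u v).
Proof. by rewrite !torsion_formula contract2_la (linN (@la_lin _ _ _ _ a)). Qed.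

Definition torsion_ten (t : tensor X X) : X := \sw_(u, v <- t) torsion nabla u v.
Lemma torsion_ten_linear : linear torsion_ten.
Proof. exact: tlift_linear torsion_bal. Qed.
Lemma torsion_tenE u v : torsion_ten (ten u v) = torsion nabla u v.
Proof. exact: (tlift_ten _ _ torsion_bal). Qed.

Lemma torsion_ten_la a t : torsion_ten (la a t) = la a (torsion_ten t).
Proof.
move: t; apply: (tensor_ext (f := fun t => torsion_ten (la a t))
  (g := fun t => la a (torsion_ten t))).
- by apply: lin_app; [exact: torsion_ten_linear|exact: la_lin].
- by apply: lin_app; [exact: la_lin|exact: torsion_ten_linear].
by move=> u v; rewrite ten_la !torsion_tenE torsion_la.
Qed.

(** Braiding twice is the identity, so a braided commutator changes sign when its
    arguments are braided. *)
Lemma braided_commutator_antisym (M : lmodType k) (F : X -> X -> M) u v : bilin F ->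
  let T u v := F u v - \sw_(x, y <- Rb) F (ha x v) (ha y u) in
  \sw_(x, y <- Rb) T (ha x v) (ha y u) = - T u v.
Proof.
move=> [Fl Fr] T.
have lF (U : lmodType k) (g : U -> X) x : linear g -> linear (fun z => F (g z) x).
  exact: (lin_app (f := F^~ x)).
have rF (U : lmodType k) (g : U -> X) x : linear g -> linear (fun z => F x (g z)).
  exact: (lin_app (f := F x)).
rewrite /T opprB.
transitivity (\sw_(x, y <- Rb) F (ha x v) (ha y u) -
  \sw_(p, q <- Rb) \sw_(x, y <- Rb) F (ha (x * q) u) (ha (y * p) v)).
  rewrite /tlift -sumrB; apply: eq_bigr => c _; congr (_ - _).
  by apply: eq_bigr => c' _; rewrite !haM.
congr (_ - _); rewrite exch_tlift.
rewrite (Rinv_flip (F := fun x y => F (ha x u) (ha y v))) ?ha1 //.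
by repeat first [lin_step | apply: lF | apply: rF].
Qed.

(** Both the covariant part of the torsion and the bracket are braided
    commutators. *)
Lemma torsion_antisym u v :
  \sw_(x, y <- Rb) torsion nabla (ha x v) (ha y u) = - torsion nabla u v.
Proof.
have bn : bilin (nabla_at nabla).
  by split=> x; [exact: lin_nabla_atl|exact: lin_nabla_atr].
have bE a : \sw_(x, y <- Rb) bracket_fun (ha x v) (ha y u) a = - bracket_fun u v a.
  by apply: (braided_commutator_antisym (M := A) (F := fun u v => vapp u (vapp v a))); plin.
have bracketE : \sw_(x, y <- Rb) bracket (ha x v) (ha y u) = - bracket u v.
  by apply: vf_ext => a; rewrite (tlift_app _ _ (@vapp_linl _ _ _ a)); exact: bE.
transitivity (\sw_(x, y <- Rb) (nabla_at nabla (ha x v) (ha y u)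
     - \sw_(p, q <- Rb) nabla_at nabla (ha p (ha y u)) (ha q (ha x v)))
   - \sw_(x, y <- Rb) bracket (ha x v) (ha y u)).
  by rewrite /tlift -sumrB.
rewrite braided_commutator_antisym // bracketE.
exact: (esym (opprD _ _)).
Qed.

Lemma torsion_ten_tau t : torsion_ten (tau t) = - torsion_ten t.
Proof.
have [lt _ _] := mor_tau X X.
move: t; apply: (tensor_ext (f := fun t => torsion_ten (tau t))
  (g := fun t => - torsion_ten t)).
- by apply: lin_app; [exact: torsion_ten_linear|].
- by apply: lin_opp; exact: torsion_ten_linear.
move=> u v; rewrite tau_ten torsion_tenE -torsion_antisym.
by rewrite (tlift_app _ _ torsion_ten_linear); apply: tlift_eq => x y; rewrite torsion_tenE.
Qed.
End Torsion.

(** * Left linear maps on bivector fields *)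

Section Bivectors.
Variables (k : comUnitRingType) (H : triHopf k) (A : bcModAlg H).
Notation X := (VF A).
Hypothesis two_unit : (2%:R : k) \is a GRing.unit.

Definition bivector (t : tensor X X) : X2 A := im_mk (mor_antisym2 A) t.

Lemma bivector_linear : linear bivector.
Proof. by have [l _ _] := mor_antisym2 A; move=> c s t; apply: val_inj; apply: l. Qed.

Lemma bivector_surj (b : X2 A) : exists t, b = bivector t.
Proof. by have /asboolP[t Et] := valP b; exists t; apply: val_inj. Qed.

Lemma wedgeX_tau (u v : X) : wedgeX u v = ten u v - tau (ten u v).
Proof. by rewrite tau_ten. Qed.

Lemma wedgeX_val (u v : X) : im_val (2%:R *: bivector (ten u v)) = wedgeX u v.
Proof.
rewrite -[im_val _]/(2%:R *: (2%:R^-1 *: (ten u v - tau (ten u v)))).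
by rewrite scalerA divrr // scale1r wedgeX_tau.
Qed.

(** The elements u /\ v span X^2(A), 2 being invertible. *)
Lemma bivector_hom_ext (L M : hom (X2 A) X) :
  (forall (u v : X) (b : X2 A), im_val b = wedgeX u v -> happ L b = happ M b) -> L = M.
Proof.
move=> E; apply: hom_ext => b; have [t ->] := bivector_surj b.
move: t; apply: (tensor_ext (f := fun t => happ L (bivector t))
  (g := fun t => happ M (bivector t))).
- by apply: lin_app; [exact: happ_lin|exact: bivector_linear].
- by apply: lin_app; [exact: happ_lin|exact: bivector_linear].
move=> u v; have := E u v _ (wedgeX_val u v).
rewrite (linZ (@happ_lin _ _ _ _ _ L)) (linZ (@happ_lin _ _ _ _ _ M)).
by move/(congr1 ( *:%R 2%:R^-1)); rewrite !scalerA mulVr // !scale1r.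
Qed.
End Bivectors.

Theorem theorem4p7
    (k : comUnitRingType) (k_base : char0_field k \/ char0_fps k)
    (H : triHopf k) (A : bcModAlg H)
    (X_fg : fg (VF A)) (X_proj : projective (VF A))
    (Omega_fg : fg (Omega A)) (Omega_proj : projective (Omega A))
    (d : forall r, Om A r -> Om A r.+1) (d_ext : exterior_derivative d)
    (nabla : VF A -> tensor (Omega A) (VF A)) (nabla_conn : left_connection nabla)
    (n : nat) (e : 'I_n -> VF A) (w : 'I_n -> Omega A)
    (dual_bases : forall u, u = \sum_i la (pairing u (w i)) (e i)) :
  let I : tensor (Om A 1) (VF A) :=
    \sum_i ten (alt (V := Omega A) (r := 1) (w i)) (e i) in
  (forall u v : VF A,
     torsion nabla u v =
     - lunit (ins_conn u (ins_conn v (incl_conn (dconn d nabla I))))) /\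
  (exists! L : hom (X2 A) (VF A), forall u v : VF A,
     exists2 t : X2 A, im_val t = wedgeX u v &
       torsion nabla u v = 2%:R^-1 *: happ L t).
Proof.
move=> I; have unit2 := char0_two_unit k_base; split.
  exact: (torsion_formula unit2 d_ext nabla_conn dual_bases).
have lT := torsion_ten_linear unit2 d_ext nabla_conn dual_bases.
have TE := torsion_tenE unit2 d_ext nabla_conn dual_bases.
have Twedge u v : torsion_ten nabla (wedgeX u v) = 2%:R *: torsion nabla u v.
  rewrite wedgeX_tau (linD lT) (linN lT).
  rewrite (torsion_ten_tau unit2 d_ext nabla_conn dual_bases) opprK TE.
  by rewrite -mulr2n scaler_nat.
have llT : left_linear (fun b : X2 A => torsion_ten nabla (im_val b)).
  split=> [c b b'|a b]; first exact: lT.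
  exact: (torsion_ten_la unit2 d_ext nabla_conn dual_bases a (im_val b)).
exists (mk_hom llT); split=> [u v|L LP].
  exists (2%:R *: bivector (ten u v)); first exact: wedgeX_val.
  by rewrite mk_homE wedgeX_val // Twedge scalerA mulVr // scale1r.
apply: bivector_hom_ext => // u v b Eb; have [b' Eb' T'] := LP u v.
have -> : b = b' by apply: val_inj; rewrite -[LHS]/(im_val b) Eb -Eb'.
by rewrite mk_homE Eb' Twedge T' scalerA divrr // scale1r.
Qed.
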